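(* Let $p\ge2$ be an integer. Consider a tame asymptotic $p$-model $V$ with torsion on the strip $\mathbb S_p$, and let $\varphi$ be its time-one map. Then $\mathrm C(\varphi)=2$.
   Context: **Complexity index.** For a compact metric space $(X,d)$ and a continuous map $\varphi:X\to X$, let $d_n^\varphi(x,y)=\max_{0\le k\le n-1}d(\varphi^k(x),\varphi^k(y))$ ($n\ge1$), let $G_n(\varepsilon)$ be the minimal number of open $d_n^\varphi$-balls of radius $\varepsilon$ in a covering of $X$, and $\mathrm C(\varphi)=\sup_{\varepsilon>0}\inf\{\sigma\ge0:\lim_{n\to\infty}n^{-\sigma}G_n(\varepsilon)=0\}$. This does not depend on the choice of topologically equivalent metrics on $X$. **Strip.** Fix an integer $p\ge2$ and a smooth function $\eta_p$ on $[0,1/p]$ with $\eta_p(0)=0$, $\eta_p(7/(8p))=1$, $\eta_p'(x)>0$ for $x\in\,]0,7/(8p)[$, $\eta_p^{(k)}(7/(8p))=0$ for all $k\ge1$, $\eta_p=1$ on $[7/(8p),1/p]$, and $\eta_p'$ constant on $[0,1/(8p)]$. The strip $\mathbb S_p\subset\mathbb R^2$ is the set of points $(x,y)$ such that: $x\in[1/p,1-1/p]$ and $y\in[0,1]$; or $x\in[0,1/p]$ and $0\le y\le\eta_p(x)$; or $x\in[1-1/p,1]$ and $0\le y\le\eta_p(1-x)$. It carries the metric induced from $\mathbb R^2$. Put $O_\alpha=(0,0)$, $O_\omega=(1,0)$ and $O_k=(k/p,0)$ for $1\le k\le p-1$. The flat zone is the subset of $\mathbb S_p$ defined by $7/(8p)\le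 x\le1-7/(8p)$. **Asymptotic $p$-model.** This is any $C^\infty$ vector field $V=(X,Y)$ defined on $\mathbb S_p$ (it is taken to have a well-defined smooth global flow $(\varphi_t)_{t\in\mathbb R}$) satisfying: (C1) $Y(x,y)=0$ if $x\in[1/p,1-1/p]$, and $X(x,y)>0$ if $y>0$ (so the orbits are horizontal between the segments $x=1/p$ and $x=1-1/p$ and oriented from left to right); (C2) $O_\alpha$, $O_\omega$, $O_k$ ($1\le k\le p-1$) are the only fixed points of $V$ and they are connected by heteroclinic orbits, that is: $X(k/p,0)=0$ for $0\le k\le p$, and $X(x,0)>0$ for $x\in[0,1]$ with $x\notin\{0,1/p,\dots,1\}$; (C3) for $1\le k\le p-1$, in the neighborhood of $O_k$ defined by $x\in[\frac{k-1/8}{p},\frac{k+1/8}{p}]$, $X(x,y)=\ell_k\sqrt{y+(x-\frac kp)^2}$ with $\ell_k>0$ constant; (C4) in the neighborhood of $O_\alpha$ defined by $x\in[0,1/(8p)]$, $X(x,y)=\ell_\alpha x$ and $Y(x,y)=\ell_\alpha y$ with $\ell_\alpha>0$ constant; in the neighborhood of $O_\omega$ defined by $x\in[1-1/(8p),1]$, $X(x,y)=-\ell_\omega(x-1)$ and $Y(x,y)=-\ell_\omega y$ with $\ell_\omega>0$ constant. The time-one map is $\varphi=\varphi_1$. **Torsion.** $V$ has torsion (satisfies the torsion condition) when for all $x\in\,]0,1[$ and all $0<y_1<y_2$ with $(x,y_1),(x,y_2)\in\mathbb S_p$, writing $\varphi_t(x,y_i)=(x_i(t),y_i(t))$, one has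 $x_1(t)\le x_2(t)$ for all $t\ge0$, with the stronger condition $x_1(t)<x_2(t)$ for all $t>0$ when $7/(8p)\le x\le1-7/(8p)$ (the initial points are in the flat zone). **Tameness.** For two points $a,a'$ on the same orbit of $V$, with $\varphi_t(a)=(x(t),y(t))$ and $\varphi_t(a')=(x'(t),y'(t))$, the separation function is $E_{a,a'}(t)=|x'(t)-x(t)|$. A fundamental domain for the system is a subset $K$ of $\mathbb S_p$ limited by a vertical segment $\Delta$ on the left and by its image $\varphi(\Delta)$ on the right; a fundamental domain on an orbit is the part of the orbit limited by a point and its image by $\varphi$. $V$ is tame when there exists a fundamental domain $K$, contained in the flat zone, such that if $a$ and $a'$ are on the same orbit of $V$ and are contained in a fundamental domain on this orbit, then for each $t_0$ such that $E_{a,a'}(t_0)$ is maximum, the points $\varphi_{t_0}(a)$ and $\varphi_{t_0}(a')$ are located inside $K$.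
   Formalization: As (C3) makes X non-differentiable at O_k (1≤k≤p-1), X and the flow are required C^∞ only away from these points (Y everywhere, flow continuous everywhere); tameness is required only for a≠a' on orbits with y>0, since it cannot hold for a=a' or on the side y=0. *)

(* Defs.v *)
From mathcomp Require Export all_boot all_order all_algebra.
From mathcomp Require Export all_classical all_reals all_analysis.

Set Implicit Arguments.
Unset Strict Implicit.
Unset Printing Implicit Defensive.

Import Order.TTheory GRing.Theory Num.Theory.
Export numFieldNormedType.Exports.

Local Open Scope classical_set_scope.
Local Open Scope ring_scope.

(** * Complexity index of a map [f : A -> A], for a distance [d] on [A] *)

Definition bowen_dist (R : realType) (T : Type) (d : T -> T -> R) (f : T -> T)
    (n : nat) (x y : T) : R :=
  \big[Num.max/0]_(k < n) d (iter k f x) (iter k f y).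

(* Extended-real valued, so that it is +oo when there is no finite covering;
   on a compact space it is a natural number. *)
Definition covering_number (R : realType) (T : Type) (d : T -> T -> R)
    (A : set T) (f : T -> T) (n : nat) (e : R) : \bar R :=
  ereal_inf [set (m%:R)%:E | m in [set m : nat |
    exists c : 'I_m -> T, (forall i, A (c i)) /\
      forall x, A x -> exists i, bowen_dist d f n (c i) x < e]].

Definition complexity_index (R : realType) (T : Type) (d : T -> T -> R)
    (A : set T) (f : T -> T) : \bar R :=
  ereal_sup [set ereal_inf [set s%:E | s in [set s : R | 0 <= s /\
      ((fun n : nat => ((n%:R `^ (- s))%:E * covering_number d A f n e)%E)
        @ \oo --> 0%E)]]
    | e in [set e : R | 0 < e]].

(** * Smooth maps *)

(* All iterated directional derivatives up to order [n] exist and are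
   continuous on [U]; for finite-dimensional [E] and open [U] this is the usual
   class C^n. *)
Fixpoint class_C (R : realType) (E F : normedModType R) (n : nat) (U : set E)
    (f : E -> F) : Prop :=
  (forall x, U x -> {for x, continuous f}) /\
  (if n is m.+1 then
     forall v : E, (forall x, U x -> derivable f x v) /\ class_C m U ('D_v f)
   else True).

(* Smoothness on an arbitrary subset: local existence of smooth extensions. *)
Definition smooth_on (R : realType) (E F : normedModType R) (A : set E)
    (f : E -> F) : Prop :=
  forall a, A a -> exists (U : set E) (g : E -> F),
    [/\ open U, U a, (forall n, class_C n U g) &
        forall x, U x -> A x -> g x = f x].

(** * The strip *)

(* Only the values of [eta] on [0, 1/p] matter.  The slope is prescribed on
   ]0, 1/(8p)]; the one-sided derivative at 0 is then the same constant. *)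
Record profile (R : realType) (p : nat) (eta : R -> R) : Prop := Profile {
  profile_smooth : @smooth_on R R R `[0, p%:R^-1] eta ;
  profile_0 : eta 0 = 0 ;
  profile_1 : eta (7 / (8 * p%:R)) = 1 ;
  profile_incr : forall x : R, 0 < x < 7 / (8 * p%:R) -> 0 < derive1 eta x ;
  profile_flat : forall k, (0 < k)%N -> derive1n k eta (7 / (8 * p%:R)) = 0 ;
  profile_cst : forall x : R, 7 / (8 * p%:R) <= x <= p%:R^-1 -> eta x = 1 ;
  profile_lin : exists c : R,
    forall x : R, 0 < x <= (8 * p%:R)^-1 -> derive1 eta x = c }.

Definition strip (R : realType) (p : nat) (eta : R -> R) : set (R * R) :=
  [set a | [\/ p%:R^-1 <= a.1 <= 1 - p%:R^-1 /\ 0 <= a.2 <= 1,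
               0 <= a.1 <= p%:R^-1 /\ 0 <= a.2 <= eta a.1 |
               1 - p%:R^-1 <= a.1 <= 1 /\ 0 <= a.2 <= eta (1 - a.1)]].

(* The default norm on [R * R] is the sup norm. *)
Definition euclid_dist (R : realType) (a b : R * R) : R :=
  Num.sqrt ((a.1 - b.1) ^+ 2 + (a.2 - b.2) ^+ 2).

Definition in_flat_range (R : realType) (p : nat) (x : R) : bool :=
  7 / (8 * p%:R) <= x <= 1 - 7 / (8 * p%:R).

Definition flat_zone (R : realType) (p : nat) (eta : R -> R) : set (R * R) :=
  [set a | strip p eta a /\ in_flat_range p a.1].

(* [Opt p 0] and [Opt p p] are the points O_alpha and O_omega. *)
Definition Opt (R : realType) (p k : nat) : R * R := (k%:R / p%:R, 0).

Definition inner_Opts (R : realType) (p : nat) : set (R * R) :=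
  [set Opt R p k | k in [set k | (0 < k < p)%N]].

(** * Asymptotic p-models *)

(* The formula [model_saddle] is not differentiable at the points O_k,
   0 < k < p, and neither is the resulting flow.  So the first component of
   [V], and the flow, are required to be smooth away from these points only;
   the second component of [V] is smooth on the whole strip.

   Invariance of the strip under [phi t] for all real [t] forces the second
   component of [V] to vanish on the side y = 0, which is thus a union of fixed
   points and heteroclinic orbits, by [model_Opt] and [model_bottom]. *)
Record asymptotic_model (R : realType) (p : nat) (eta : R -> R)
    (V : R * R -> R * R) : Prop := AsymptoticModel {
  model_smooth1 : @smooth_on R (R * R)%type R (strip p eta `\` inner_Opts p)
                            (fun a => (V a).1) ;
  model_smooth2 : @smooth_on R (R * R)%type R (strip p eta) (fun a => (V a).2) ;
  model_horizontal : forall a, strip p eta a ->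
    p%:R^-1 <= a.1 <= 1 - p%:R^-1 -> (V a).2 = 0 ;
  model_right : forall a, strip p eta a -> 0 < a.2 -> 0 < (V a).1 ;
  model_Opt : forall k, (k <= p)%N -> (V (Opt R p k)).1 = 0 ;
  model_bottom : forall x : R, 0 <= x <= 1 ->
    (forall k, (k <= p)%N -> x <> k%:R / p%:R) -> 0 < (V (x, 0)).1 ;
  model_saddle : forall k, (0 < k < p)%N -> exists l : R, 0 < l /\
    forall a, strip p eta a ->
      (k%:R - 8^-1) / p%:R <= a.1 <= (k%:R + 8^-1) / p%:R ->
      (V a).1 = l * Num.sqrt (a.2 + (a.1 - k%:R / p%:R) ^+ 2) ;
  model_alpha : exists l : R, 0 < l /\
    forall a, strip p eta a -> 0 <= a.1 <= (8 * p%:R)^-1 ->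
      V a = (l * a.1, l * a.2) ;
  model_omega : exists l : R, 0 < l /\
    forall a, strip p eta a -> 1 - (8 * p%:R)^-1 <= a.1 <= 1 ->
      V a = (- l * (a.1 - 1), - l * a.2) }.

Record global_flow (R : realType) (p : nat) (eta : R -> R)
    (V : R * R -> R * R) (phi : R -> R * R -> R * R) : Prop := GlobalFlow {
  flow_strip : forall t a, strip p eta a -> strip p eta (phi t a) ;
  flow_0 : forall a, strip p eta a -> phi 0 a = a ;
  flow_add : forall s t a, strip p eta a -> phi (s + t) a = phi s (phi t a) ;
  flow_ode : forall (t : R) (a : R * R), strip p eta a ->
    is_derive t (1 : R) (fun s : R => phi s a) (V (phi t a)) ;
  flow_continuous : {within [set: R] `*` strip p eta,
    continuous (fun q : R * (R * R) => phi q.1 q.2)} ;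
  flow_smooth : @smooth_on R (R * (R * R))%type (R * R)%type
    ([set: R] `*` (strip p eta `\` inner_Opts p))
    (fun q : R * (R * R) => phi q.1 q.2) }.

Definition torsion (R : realType) (p : nat) (eta : R -> R)
    (phi : R -> R * R -> R * R) : Prop :=
  forall x y1 y2 : R, 0 < x < 1 -> 0 < y1 < y2 ->
    strip p eta (x, y1) -> strip p eta (x, y2) ->
    (forall t : R, 0 <= t -> (phi t (x, y1)).1 <= (phi t (x, y2)).1) /\
    (in_flat_range p x ->
       forall t : R, 0 < t -> (phi t (x, y1)).1 < (phi t (x, y2)).1).

Definition separation (R : realType) (phi : R -> R * R -> R * R)
    (a a' : R * R) (t : R) : R :=
  `|(phi t a').1 - (phi t a).1|.

(* Part of the orbit of [b] limited by [b] and its image under [phi 1]. *)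
Definition orbit_domain (R : realType) (phi : R -> R * R -> R * R)
    (b : R * R) : set (R * R) :=
  [set phi s b | s in `[0, 1]].

(* The region limited by the vertical segment of abscissa [x0] and its image
   under [phi 1] is what that segment sweeps out during the times of [0, 1]. *)
Definition fundamental_domain (R : realType) (p : nat) (eta : R -> R)
    (phi : R -> R * R -> R * R) (K : set (R * R)) : Prop :=
  exists x0 : R, 0 < x0 < 1 /\
    K = \bigcup_(b in [set b | strip p eta b /\ b.1 = x0]) orbit_domain phi b.

(* The two points are distinct (otherwise the separation is constantly 0), and
   their orbit is not in the side y = 0: that side carries p non-trivial
   orbits with pairwise disjoint projections to the x-axis, whose separation
   functions cannot all reach their maxima in a single fundamental domain. *)
Definition tame (R : realType) (p : nat) (eta : R -> R)
    (phi : R -> R * R -> R * R) : Prop :=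
  exists K : set (R * R),
    [/\ fundamental_domain p eta phi K, K `<=` flat_zone p eta &
      forall b a a' : R * R, strip p eta b -> 0 < b.2 ->
        orbit_domain phi b a -> orbit_domain phi b a' -> a <> a' ->
        forall t0 : R,
          (forall t, separation phi a a' t <= separation phi a a' t0) ->
          K (phi t0 a) /\ K (phi t0 a')].

(* Main.v *)
(* Proof idea.  The covering numbers G_n grow like n^2; torsion is only needed
   for the upper bound.

   Upper bound.  Cut the strip by a fine grid of verticals.  An orbit is known
   up to a small error on the times 0, ..., n-1 from the cell where it starts,
   the (rounded) time at which it leaves that cell through a vertical x = w, and
   the itinerary of the point (w, y) through which it leaves.  Along x = w,
   torsion makes the abscissa at each given time nondecreasing in y, and the
   height at each given vertical is nondecreasing in y because orbits do not
   cross, so there are only O(n) itineraries for each w, whence O(n^2) choices.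

   Lower bound.  Let x = c1 and x = c2 be verticals on either side of the saddle
   O_1.  As O_1 is fixed, the time from x = c1 to x = c2 is unbounded, and by
   continuity it takes every large integer value m, say at a point b_m of
   x = c1.  The points phi_(-j)(b_m) are pairwise separated: two of them cross
   c1, or else c2, at times which differ by at least 1. *)
Require Import Defs.
From mathcomp Require Import all_boot all_order all_algebra.
From mathcomp Require Import all_classical all_reals all_analysis.
From mathcomp Require Import ring lra zify.

Set Implicit Arguments.
Unset Strict Implicit.
Unset Printing Implicit Defensive.

Import Order.TTheory GRing.Theory Num.Theory.
Import numFieldNormedType.Exports.

Local Open Scope classical_set_scope.
Local Open Scope ring_scope.

(** * Compactness of the strip *)

Lemma smooth_on_within_continuous (R : realType) (E F : normedModType R)
    (A : set E) (f : E -> F) : smooth_on A f -> {within A, continuous f}.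
Proof.
move=> sf; apply/subspace_continuousP => a Aa.
have [U [g [oU Ua gC gf]]] := sf a Aa.
have [/(_ a Ua) gca _] := gC 0%N.
suff : f @ within A (nbhs a) --> g a by rewrite gf.
have gfE : \forall x \near within A (nbhs a), g x = f x.
  by apply: filter_app (open_nbhs_nbhs (conj oU Ua)); near=> x => Ux Ax; exact: gf.
apply: cvg_trans; first exact: (near_eq_cvg gfE).
exact: cvg_within_filter.
Unshelve. all: end_near. Qed.

Section strip_compact.
Context {R : realType} (p : nat) (eta : R -> R).
Hypothesis heta : profile p eta.

(** Only the values of [eta] on [0, 1/p] are controlled. Composed with the projection onto that
    interval, it is continuous on the whole line, so the strip is cut out by weak inequalities
    between continuous functions. *)
Let clamp (x : R) := Num.max 0 (Num.min x p%:R^-1).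

Let clamp_itv x : clamp x \in `[0, p%:R^-1].
Proof.
rewrite in_itv /= /clamp le_max lexx /= ge_max invr_ge0 ler0n /=.
by rewrite ge_min lexx orbT.
Qed.

Let clamp_id x : 0 <= x <= p%:R^-1 -> clamp x = x.
Proof. by move=> /andP[x0 xp]; rewrite /clamp min_l // max_r. Qed.

Let eta_clamp_continuous : continuous (eta \o clamp).
Proof.
have ceta := smooth_on_within_continuous (profile_smooth heta).
move/subspace_continuousP : ceta => ceta x.
have cc : continuous clamp.
  move=> z; have cst c : {for z, continuous (fun=> c : R^o)} by exact: cst_continuous.
  have cid : {for z, continuous (fun x : R => x : R^o)} by [].
  exact: (continuous_max (cst 0) (continuous_min cid (cst _))).
apply: (@cvg_comp _ _ _ clamp eta _ (within `[0, p%:R^-1] (nbhs (clamp x)))).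
  move=> W WW; have h : \forall z \near x, clamp z \in `[0, p%:R^-1] -> W (clamp z).
    exact: (cc x _ WW).
  by apply: filterS h => z; apply.
exact: (ceta (clamp x) (clamp_itv x)).
Qed.

Lemma strip_closed : closed (strip p eta).
Proof.
have -> : strip p eta =
  ([set a | p%:R^-1 <= a.1 <= 1 - p%:R^-1 /\ 0 <= a.2 <= 1] `|`
   [set a | 0 <= a.1 <= p%:R^-1 /\ 0 <= a.2 <= (eta \o clamp) a.1]) `|`
   [set a | 1 - p%:R^-1 <= a.1 <= 1 /\ 0 <= a.2 <= (eta \o clamp) (1 - a.1)].
  apply/seteqP; split=> -[x y] /=.
    case=> h; first by left; left.
      by left; right; rewrite clamp_id //; case: h.
    right; case: h => /= h1; rewrite (@clamp_id (1 - x)) //=.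
    by move: (p%:R^-1) h1 => q h1; lra.
  case=> [[h|h]|h]; first exact: Or31.
      by apply: Or32; case: h => h1; rewrite clamp_id.
  apply: Or33; case: h => /= h1; rewrite (@clamp_id (1 - x)) //=.
  by move: (p%:R^-1) h1 => q h1; lra.
have c1 (f g : R * R -> R) : continuous f -> continuous g ->
    closed [set a | f a <= g a].
  move=> cf cg.
  rewrite (_ : [set a | _] = (fun a => g a - f a) @^-1` [set z | 0 <= z]).
    apply: preimage_closed; first by move=> a _; apply: cvgB; [exact: cg|exact: cf].
    exact: closed_ge.
  by apply/seteqP; split => a /=; rewrite subr_ge0.
have cst c : continuous (fun _ : R * R => c : R) by exact: cst_continuous.
have cfst : continuous (fun a : R * R => a.1) by move=> a; exact: cvg_fst.
have csnd : continuous (fun a : R * R => a.2) by move=> a; exact: cvg_snd.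
have c4 (f1 f2 f3 f4 f5 f6 : R * R -> R) : continuous f1 -> continuous f2 -> continuous f3 ->
    continuous f4 -> continuous f5 -> continuous f6 ->
    closed [set a : R * R | f1 a <= f2 a <= f3 a /\ f4 a <= f5 a <= f6 a].
  move=> h1 h2 h3 h4 h5 h6.
  rewrite (_ : [set a | _] = (([set a | f1 a <= f2 a] `&` [set a | f2 a <= f3 a])
     `&` ([set a | f4 a <= f5 a] `&` [set a | f5 a <= f6 a]))).
    by apply: closedI; apply: closedI; apply: c1.
  apply/seteqP; split=> a /=; first by move=> [/andP[? ?] /andP[? ?]].
  by move=> [[? ?] [? ?]]; split; apply/andP.
apply: closedU; first apply: closedU.
- by apply: c4.
- apply: c4 => //; move=> a.
  by apply: (@continuous_comp _ _ _ fst); [exact: cfst|exact: eta_clamp_continuous].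
- apply: c4 => // a.
  apply: (@continuous_comp _ _ _ (fun a : R * R => 1 - a.1)).
    by apply: cvgB; [exact: cst|exact: cfst].
  exact: eta_clamp_continuous.
Qed.

Lemma strip_ge0 a : strip p eta a -> 0 <= a.2.
Proof. by case=> -[_ /andP[]]. Qed.

Lemma strip_down x y y' : 0 <= y' <= y -> strip p eta (x, y) -> strip p eta (x, y').
Proof.
rewrite /strip /= => /andP[y'0 y'y] [] [h1 /andP[h2 h3]].
- by apply: Or31; split => //; rewrite y'0 (le_trans y'y).
- by apply: Or32; split => //; rewrite y'0 (le_trans y'y).
- by apply: Or33; split => //; rewrite y'0 (le_trans y'y).
Qed.

Hypothesis p2 : (2 <= p)%N.

Lemma invp_bound : 0 < (p%:R^-1 : R) <= 2^-1.
Proof.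
have p0 : 0 < (p%:R : R) by rewrite ltr0n (leq_trans _ p2).
rewrite invr_gt0 p0 /= lef_pV2 ?posrE ?(ler_nat R 2 p) //.
Qed.

Lemma strip_itv a : strip p eta a -> 0 <= a.1 <= 1.
Proof. rewrite /strip /=; have := invp_bound; move: (p%:R^-1) => q h; case=> -[h3 _]; lra. Qed.

(** The maximum of the clamped [eta] provides the bound, rounded up to an integer because it later
    enters a count of truncated heights. *)
Lemma strip_bounded : exists Y : nat, forall a, strip p eta a -> a.2 <= Y%:R.
Proof.
have /andP[ip0 ip2] := invp_bound.
have [c _ hc] := @EVT_max R (eta \o clamp) 0 p%:R^-1 (ltW ip0)
  (continuous_subspaceT eta_clamp_continuous).
have [n Hn] : exists n : nat, Num.max 1 ((eta \o clamp) c) <= n%:R.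
  exists (Num.bound (Num.max 1 ((eta \o clamp) c))).
  by apply/ltW/archi_boundP; rewrite le_max ler01.
exists n => -[x y].
move: Hn; rewrite ge_max => /andP[n1 nc].
case=> /= -[h1 /andP[_ h2]]; apply: (le_trans h2).
- exact: n1.
- have := hc x; rewrite in_itv /= => /(_ h1).
  by rewrite clamp_id //; move/le_trans; apply.
- have h3 : 0 <= 1 - x <= p%:R^-1 by move: (p%:R^-1) h1 => q h1; lra.
  have := hc (1 - x); rewrite in_itv /= => /(_ h3).
  by rewrite (clamp_id h3); move/le_trans; apply.
Qed.

Lemma strip_compact : compact (strip p eta).
Proof.
have [Y hY] := strip_bounded.
apply: (@subclosed_compact _ _ (`[(0:R), 1]%classic `*` `[(0:R), Y%:R]%classic)).
- exact: strip_closed.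
- by apply: compact_setX; exact: segment_compact.
- by move=> a Sa; split; rewrite /= in_itv /= ?(strip_itv Sa) ?(strip_ge0 Sa) ?hY.
Qed.

End strip_compact.

(** * Monotonicity of the flow *)

Lemma is_derive_fst (R : realType) (f : R -> R * R) (t : R) (v : R * R) :
  is_derive t 1 f v -> is_derive t 1 (fun s => (f s).1) v.1.
Proof.
move=> [df <-].
have h : (fun h : R => h^-1 *: ((f \o shift t) (h *: 1) - f t)) @ 0^' --> 'D_1 f t.
  exact: df.
have cfst : {for 'D_1 f t, continuous (@fst R R)} by exact: cvg_fst.
have {}h : (fun h : R => h^-1 *: (((fun s => (f s).1) \o shift t) (h *: 1) - (f t).1))
  @ 0^' --> ('D_1 f t).1 := continuous_cvg _ cfst h.
apply: DeriveDef.
  by apply/cvg_ex; eexists; exact: h.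
by apply: cvg_lim; [exact: Rhausdorff|exact: h].
Qed.

Lemma is_derive_snd (R : realType) (f : R -> R * R) (t : R) (v : R * R) :
  is_derive t 1 f v -> is_derive t 1 (fun s => (f s).2) v.2.
Proof.
move=> [df <-].
have h : (fun h : R => h^-1 *: ((f \o shift t) (h *: 1) - f t)) @ 0^' --> 'D_1 f t.
  exact: df.
have csnd : {for 'D_1 f t, continuous (@snd R R)} by exact: cvg_snd.
have {}h : (fun h : R => h^-1 *: (((fun s => (f s).2) \o shift t) (h *: 1) - (f t).2))
  @ 0^' --> ('D_1 f t).2 := continuous_cvg _ csnd h.
apply: DeriveDef.
  by apply/cvg_ex; eexists; exact: h.
by apply: cvg_lim; [exact: Rhausdorff|exact: h].
Qed.

Lemma is_derive_continuous (R : realType) (f df : R -> R) :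
  (forall t, is_derive t (1 : R) f (df t)) -> continuous f.
Proof.
by move=> h t; apply/differentiable_continuous/derivable1_diffP; case: (h t).
Qed.

Lemma is_derive_gt0_quotient (R : realType) (f : R -> R) (t l : R) :
  is_derive t (1 : R) f l -> 0 < l ->
  exists2 e, 0 < e & forall h, h != 0 -> `|h| < e -> 0 < (f (t + h) - f t) / h.
Proof.
move=> [df <-] l0.
have h : (fun h : R => h^-1 *: ((f \o shift t) (h *: 1) - f t)) @ 0^' --> 'D_1 f t.
  exact: df.
have : \forall z \near (0 : R), z != 0 -> 0 < z^-1 *: ((f \o shift t) (z *: 1) - f t).
  have := cvgr_gt _ h _ l0; rewrite near_withinE; exact.
move=> /nbhs_ballP[e /= e0 he]; exists e => // z z0 ze.
have := he z; rewrite -ball_normE /= sub0r normrN => /(_ ze z0).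
by rewrite [_%:A]mulr1 [z + t]addrC [_ *: _]mulrC.
Qed.

Section flow.
Context {R : realType} (p : nat) (eta : R -> R) (V : R * R -> R * R)
  (phi : R -> R * R -> R * R).
Hypothesis p2 : (2 <= p)%N.
Hypothesis heta : profile p eta.
Hypothesis hV : asymptotic_model p eta V.
Hypothesis hphi : global_flow p eta V phi.

Lemma flow1_is_derive a t : strip p eta a ->
  is_derive t (1 : R) (fun s => (phi s a).1) (V (phi t a)).1.
Proof. by move=> Sa; apply: is_derive_fst; exact: (flow_ode hphi). Qed.

Lemma flow2_is_derive a t : strip p eta a ->
  is_derive t (1 : R) (fun s => (phi s a).2) (V (phi t a)).2.
Proof. by move=> Sa; apply: is_derive_snd; exact: (flow_ode hphi). Qed.

Lemma flow1_continuous a : strip p eta a -> continuous (fun s => (phi s a).1).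
Proof.
by move=> Sa; apply: is_derive_continuous => t; exact: flow1_is_derive.
Qed.

Lemma flow2_continuous a : strip p eta a -> continuous (fun s => (phi s a).2).
Proof.
by move=> Sa; apply: is_derive_continuous => t; exact: flow2_is_derive.
Qed.

Lemma V1_ge0 a : strip p eta a -> 0 <= (V a).1.
Proof.
move=> Sa; have := strip_ge0 Sa; rewrite le_eqVlt => /predU1P[a20|a20]; last first.
  by apply/ltW; exact: (model_right hV).
have [[k kp ak]|nk] := pselect (exists2 k, (k <= p)%N & a.1 = k%:R / p%:R).
  by rewrite (surjective_pairing a) -a20 ak (model_Opt hV).
rewrite (surjective_pairing a) -a20 ltW // (model_bottom hV) ?(strip_itv p2 Sa) //.
by move=> k kp ak; apply: nk; exists k.
Qed.

Lemma V1_eq0 a : strip p eta a -> (V a).1 = 0 ->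
  exists2 k, (k <= p)%N & a = Opt R p k.
Proof.
move=> Sa Va0; have := strip_ge0 Sa; rewrite le_eqVlt => /predU1P[a20|a20]; last first.
  by have := model_right hV Sa a20; rewrite Va0 ltxx.
have [[k kp ak]|nk] := pselect (exists2 k, (k <= p)%N & a.1 = k%:R / p%:R).
  by exists k => //; rewrite (surjective_pairing a) -a20 ak.
have := @model_bottom _ _ _ _ hV a.1 (strip_itv p2 Sa).
rewrite [in (a.1, 0)]a20 -surjective_pairing Va0 ltxx => h.
by have /h : forall k, (k <= p)%N -> a.1 <> k%:R / p%:R
  by move=> k kp ak; apply: nk; exists k.
Qed.

Lemma V1_gt0 a : strip p eta a -> (forall k, (k <= p)%N -> a <> Opt R p k) ->
  0 < (V a).1.
Proof.
move=> Sa nk; rewrite lt_neqAle V1_ge0 // andbT; apply/eqP => /esym /(V1_eq0 Sa)[k kp].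
exact: nk.
Qed.

Lemma flow1_homo a s t : strip p eta a -> s <= t -> (phi s a).1 <= (phi t a).1.
Proof.
move=> Sa st.
have [||c _] := @MVT_segment R (fun s => (phi s a).1) (fun t => (V (phi t a)).1) s t st.
- by move=> z _; exact: flow1_is_derive.
- by apply: continuous_subspaceT => z; exact: flow1_continuous.
move=> h; rewrite -subr_ge0 h mulr_ge0 ?subr_ge0 // V1_ge0 //.
exact: (flow_strip hphi).
Qed.

Lemma flowD a s t : strip p eta a -> phi s (phi t a) = phi (s + t) a.
Proof. by move=> Sa; rewrite (flow_add hphi). Qed.

Lemma flowNK a s : strip p eta a -> phi (- s) (phi s a) = a.
Proof. by move=> Sa; rewrite flowD // addNr (flow_0 hphi). Qed.

Lemma flowK a s : strip p eta a -> phi s (phi (- s) a) = a.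
Proof. by move=> Sa; rewrite flowD // addrN (flow_0 hphi). Qed.

(** The positive derivative at time 0 gives strict progress at a small time [h <= s], and weak
    monotonicity keeps it up to [s]. *)
Lemma flow1_gt a s : strip p eta a -> 0 < (V a).1 -> 0 < s -> a.1 < (phi s a).1.
Proof.
move=> Sa Va s0.
have D := flow1_is_derive 0 Sa; rewrite (flow_0 hphi) // in D.
have [e e0 he] := is_derive_gt0_quotient D Va.
pose h := Num.min s (e / 2).
have h0 : 0 < h by rewrite lt_min s0 /= divr_gt0.
have he' : `|h| < e.
  by rewrite gtr0_norm // /h gt_min; apply/orP; right; rewrite ltr_pdivrMr // ltr_pMr // ltr1n.
have := he h (lt0r_neq0 h0) he'; rewrite pmulr_lgt0 ?invr_gt0 // subr_gt0 add0r (flow_0 hphi) //.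
by move=> /lt_le_trans; apply; apply: flow1_homo => //; rewrite ge_min lexx.
Qed.

Lemma flow1_lt a s : strip p eta a -> 0 < (V a).1 -> s < 0 -> (phi s a).1 < a.1.
Proof.
move=> Sa Va s0.
have D := flow1_is_derive 0 Sa; rewrite (flow_0 hphi) // in D.
have [e e0 he] := is_derive_gt0_quotient D Va.
pose h := Num.max s (- (e / 2)).
have h0 : h < 0 by rewrite gt_max s0 /= oppr_lt0 divr_gt0.
have he' : `|h| < e.
  rewrite ltr0_norm // ltrNl /h lt_max; apply/orP; right; rewrite ltrN2.
  by rewrite ltr_pdivrMr // ltr_pMr // ltr1n.
have := he h (ltr0_neq0 h0) he'; rewrite nmulr_lgt0 ?invr_lt0 // subr_lt0 add0r (flow_0 hphi) //.
by apply: le_lt_trans; apply: flow1_homo => //; rewrite le_max lexx.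
Qed.

(** Uniformity in [a] comes from the compactness of the strip: by joint continuity near (0, a), both
    [phi s b] and [b] are within [e / 2] of [a]. *)
Lemma flow_near_id e : 0 < e -> exists2 d, 0 < d & forall a s, strip p eta a ->
  `|s| <= d -> `|(phi s a).1 - a.1| < e /\ `|(phi s a).2 - a.2| < e.
Proof.
move=> e0.
have /compact_near_coveringP/near_covering_withinP := strip_compact heta p2.
move=> /(_ R (nbhs (0 : R)) (fun s a => `|(phi s a).1 - a.1| < e /\ `|(phi s a).2 - a.2| < e)).
case.
  move=> a Sa.
  have e20 : 0 < e / 2 by rewrite divr_gt0.
  have cf : (fun q : R * (R * R) => phi q.1 q.2) @
      within ([set: R] `*` strip p eta) (nbhs (0 : R, a)) --> phi 0 a.
    by have /subspace_continuousP/(_ (0, a) (conj I Sa)) := flow_continuous hphi.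
  rewrite (flow_0 hphi) // in cf; move/cvgr_dist_lt : cf => /(_ _ e20).
  rewrite near_withinE => -[[A B] /= [nA nB] AB].
  exists (B `&` ball a (e / 2), A) => /=.
    by split => //; apply: filterI => //; exact: nbhsx_ballx.
  move=> [b s] /= [[Bb ab] As] Sb.
  have := AB (s, b) (conj As Bb) (conj I Sb); rewrite /= => h.
  move: ab; rewrite -ball_normE /= => ab.
  move: h ab; rewrite !prod_normE /= !gt_max => /andP[h1 h2] /andP[h3 h4].
  have tri (u v w : R) : `|u - v| < e / 2 -> `|u - w| < e / 2 -> `|v - w| < e.
    move=> uv uw; rewrite (splitr e); apply: le_lt_trans (ltrD uv uw).
    by rewrite [`|u - v|]distrC; exact: ler_distD.
  by split; [exact: tri h1 h3|exact: tri h2 h4].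
move=> d /= d0 hd; exists (d / 2); first by rewrite divr_gt0.
move=> a s Sa sd; apply: (hd s) => //=.
rewrite sub0r normrN (le_lt_trans sd) // ltr_pdivrMr // ltr_pMr // ltr1n //.
Qed.

Lemma flow_within_continuous t : {within strip p eta, continuous (phi t)}.
Proof.
apply/subspace_continuousP => a Sa.
have /subspace_continuousP/(_ (t, a) (conj I Sa)) := flow_continuous hphi.
move=> h W WW; have [[A B] /= [nA nB] AB] := h W WW.
apply: filterS nB => b Bb Sb; apply: (AB (t, b)) => //=.
by split => //; exact: nbhs_singleton.
Qed.

End flow.

(** * The saddles are fixed by the flow *)

Lemma compact_gt0_lower_bound (R : realType) (T : topologicalType) (K : set T)
    (f : T -> R) : compact K -> {within K, continuous f} ->
  (forall x, K x -> 0 < f x) ->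
  exists2 e, 0 < e & forall x, K x -> e <= f x.
Proof.
move=> /compact_near_coveringP/near_covering_withinP cK /subspace_continuousP cf f0.
have := cK _ (nbhs (0 : R)) (fun e x => e <= f x); case.
  move=> x Kx; have fx20 : f x / 2 < f x by rewrite ltr_pdivrMr // ltr_pMr ?f0 // ltr1n.
  have := cvgr_gt _ (cf x Kx) _ fx20; rewrite near_withinE => h.
  have h0 : \forall e \near (0 : R), e <= f x / 2.
    have fx2 : 0 < f x / 2 by rewrite divr_gt0 ?f0.
    by apply: filterS (nbhs0_lt fx2) => e /ltW; apply: le_trans; exact: ler_norm.
  exists ([set y | K y -> f x / 2 < f y], [set e | e <= f x / 2]) => //=.
    by split => //; exact: h.
  by move=> [y e] /= [h1 h2] Ky; rewrite (le_trans h2) // ltW // h1.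
move=> d /= d0 hd; exists (d / 2) => [|x Kx]; first exact: divr_gt0.
apply: (hd (d / 2)) => //=.
by rewrite sub0r normrN gtr0_norm ?divr_gt0 // ltr_pdivrMr // ltr_pMr // ltr1n.
Qed.

Section saddles.
Context {R : realType} (p : nat) (eta : R -> R) (V : R * R -> R * R)
  (phi : R -> R * R -> R * R).
Hypothesis p2 : (2 <= p)%N.
Hypothesis heta : profile p eta.
Hypothesis hV : asymptotic_model p eta V.
Hypothesis hphi : global_flow p eta V phi.

Let homo a s t := @flow1_homo R p eta V phi p2 hV hphi a s t.

(** The displacement is continuous on a compact set and, the speed being positive there, nonzero.
    The bound feeds the crossing of verticals, the separation of orbits and the control of
    heights. *)
Lemma flow1_displacement (B : set (R * R)) s : closed B ->
  (forall a, strip p eta a -> B a -> 0 < (V a).1) -> s != 0 ->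
  exists2 e, 0 < e & forall a, strip p eta a -> B a -> e <= `|(phi s a).1 - a.1|.
Proof.
move=> cB B0 s0.
have cK : compact (strip p eta `&` B).
  exact: compact_closedI (strip_compact heta p2) cB.
have := @compact_gt0_lower_bound _ _ _ (fun a => `|(phi s a).1 - a.1|) cK.
case.
- apply: (@continuous_subspaceW _ _ _ (strip p eta)); first by move=> a [].
  apply/subspace_continuousP => a Sa.
  have cf : phi s @ within (strip p eta) (nbhs a) --> phi s a.
    have /subspace_continuousP := @flow_within_continuous _ p eta V phi hphi s.
    by apply.
  apply: cvg_norm; apply: cvgB.
    have cfst : {for phi s a, continuous (@fst R R)} by exact: cvg_fst.
    exact: (continuous_cvg _ cfst cf).
  by apply: cvg_within_filter; exact: cvg_fst.
- move=> a [Sa Ba]; rewrite normr_gt0 subr_eq0.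
  have := B0 a Sa Ba; move: s0; rewrite neq_lt => /orP[s0|s0] Va0.
    by rewrite lt_eqF // (flow1_lt p2 hV hphi).
  by rewrite gt_eqF // (flow1_gt p2 hV hphi).
- by move=> e e0 he; exists e => // a Sa Ba; exact: he.
Qed.

Lemma closed_strip_itv (c d : R) : closed [set a : R * R | c <= a.1 <= d].
Proof.
rewrite (_ : [set a | _] = [set a : R * R | c <= a.1] `&` [set a | a.1 <= d]).
  apply: closedI.
    apply: (@preimage_closed (R * R)%type R fst [set x | c <= x]).
      by move=> a _; exact: cvg_fst.
    exact: closed_ge.
  apply: (@preimage_closed (R * R)%type R fst [set x | x <= d]).
    by move=> a _; exact: cvg_fst.
  exact: closed_le.
by apply/seteqP; split => a /=; [move=> /andP|move=> ?; apply/andP].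
Qed.

Lemma flow1_reaches a c : strip p eta a -> a.1 <= c ->
  (forall b, strip p eta b -> a.1 <= b.1 <= c -> 0 < (V b).1) ->
  exists2 t, 0 <= t & (phi t a).1 = c.
Proof.
move=> Sa ac h.
have [e e0 he] := flow1_displacement (@closed_strip_itv a.1 c) h (oner_neq0 _).
have stp n : a.1 + n%:R * e <= (phi n%:R a).1 \/ c <= (phi n%:R a).1.
  elim: n => [|n IH]; first by left; rewrite mul0r addr0 (flow_0 hphi).
  have [cn|cn] := leP c (phi n%:R a).1.
    by right; apply: le_trans cn _; apply: homo => //; rewrite ler_nat.
  case: IH => [IH|]; last by rewrite leNgt cn.
  left; have Sn := flow_strip hphi n%:R Sa.
  have an : a.1 <= (phi n%:R a).1.
    by rewrite -{1}(flow_0 hphi Sa); apply: homo.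
  have := he _ Sn; rewrite /= an (ltW cn) => /(_ isT).
  rewrite (flowD hphi) // ger0_norm; last first.
    by rewrite subr_ge0; apply: homo => //; rewrite lerDr.
  rewrite -natr1 [1 + _]addrC => ?; lra.
have [n hn] : exists n : nat, c - a.1 <= n%:R * e.
  exists (Num.bound ((c - a.1) / e)); rewrite -ler_pdivrMr //.
  by apply/ltW/archi_boundP/divr_ge0/ltW => //; rewrite subr_ge0.
have cn : c <= (phi n%:R a).1.
  case: (stp n) => // /(le_trans _); apply; lra.
have [||t] := @IVT R (fun s => (phi s a).1) 0 n%:R c (ler0n _ _).
- by apply: continuous_subspaceT; exact: (flow1_continuous hphi).
- by rewrite (flow_0 hphi) // ge_min ac /= le_max cn orbT.
by rewrite in_itv /= => /andP[t0 _] <-; exists t.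
Qed.

Lemma flow1_reaches_back a c : strip p eta a -> c <= a.1 ->
  (forall b, strip p eta b -> c <= b.1 <= a.1 -> 0 < (V b).1) ->
  exists2 t, 0 <= t & (phi (- t) a).1 = c.
Proof.
move=> Sa ac h.
have N10 : -1 != 0 :> R by rewrite oppr_eq0 oner_neq0.
have [e e0 he] := flow1_displacement (@closed_strip_itv c a.1) h N10.
have stp n : (phi (- n%:R) a).1 <= a.1 - n%:R * e \/ (phi (- n%:R) a).1 <= c.
  elim: n => [|n IH]; first by left; rewrite mul0r subr0 oppr0 (flow_0 hphi).
  have [cn|cn] := leP (phi (- n%:R) a).1 c.
    by right; apply: le_trans cn; apply: homo => //; rewrite lerN2 ler_nat.
  case: IH => [IH|]; last by rewrite leNgt cn.
  left; have Sn := flow_strip hphi (- n%:R) Sa.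
  have an : (phi (- n%:R) a).1 <= a.1.
    by rewrite -{2}(flow_0 hphi Sa); apply: homo => //; rewrite oppr_le0.
  have := he _ Sn; rewrite /= an (ltW cn) => /(_ isT).
  rewrite (flowD hphi) // ler0_norm; last first.
    by rewrite subr_le0; apply: homo => //; rewrite gerDr oppr_le0.
  rewrite -natr1 [- (n%:R + 1)]opprD [- 1 + _]addrC => ?; lra.
have [n hn] : exists n : nat, a.1 - c <= n%:R * e.
  exists (Num.bound ((a.1 - c) / e)); rewrite -ler_pdivrMr //.
  by apply/ltW/archi_boundP/divr_ge0/ltW => //; rewrite subr_ge0.
have cn : (phi (- n%:R) a).1 <= c.
  case: (stp n) => // /le_trans; apply; lra.
have N0 : - n%:R <= 0 :> R by rewrite oppr_le0.
have [||t] := @IVT R (fun s => (phi s a).1) (- n%:R) 0 c N0.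
- by apply: continuous_subspaceT; exact: (flow1_continuous hphi).
- by rewrite (flow_0 hphi) // ge_min cn /= le_max ac orbT.
rewrite in_itv /= => /andP[_ t0] <-; exists (- t); rewrite ?opprK //.
by rewrite oppr_ge0.
Qed.

(* The strip is invariant in negative time too, so [y] has a minimum at time 0. *)
Lemma V2_bottom x : strip p eta (x, 0) -> (V (x, 0)).2 = 0.
Proof.
move=> Sx.
have D t := flow2_is_derive hphi t Sx.
have : is_derive (0 : R) (1 : R) (fun s => (phi s (x, 0)).2) 0.
  apply: (@derive1_at_min _ _ (-1) 1).
  - lra.
  - by move=> t _; case: (D t).
  - by rewrite in_itv /=; lra.
  - move=> t _; rewrite (flow_0 hphi) //; apply: (@strip_ge0 _ p eta).
    exact: (flow_strip hphi).
by move=> [_ E0]; case: (D 0) => _; rewrite E0 (flow_0 hphi).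
Qed.

(** The second component vanishes at height 0, so the mean value theorem on a vertical segment,
    applied to a smooth extension [g], bounds it by a multiple of the height. *)
Lemma V2_lipschitz_bottom x0 : strip p eta (x0, 0) ->
  exists L d, [/\ 0 < L, 0 < d & forall a, strip p eta a ->
    `|a.1 - x0| < d -> `|a.2| < d -> `|(V a).2| <= L * a.2].
Proof.
move=> S0; have [U [g [oU U0 gC gV]]] := model_smooth2 hV S0.
have [_ /(_ (0, 1)) [dg [cg _]]] := gC 1%N.
pose L := `|'D_(0, 1) g (x0, 0)| + 1.
have LL : `|'D_(0, 1) g (x0, 0)| < L by rewrite ltrDl.
have nL : \forall a \near (x0, 0 : R), `|'D_(0, 1) g a| < L.
  exact: cvgr_norm_lt (cg _ U0) _ LL.
have [d /= d0 hd] : nbhs_ball (x0, 0 : R) (U `&` [set a | `|'D_(0, 1) g a| < L]).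
  by apply/nbhs_ballP; exact: filterI (open_nbhs_nbhs (conj oU U0)) nL.
exists L, d; split => //; first by rewrite /L ltr_wpDl.
move=> [x y] /= Sa xd yd; have y0 : 0 <= y := strip_ge0 Sa.
have hb s : 0 <= s <= y -> U (x, s) /\ `|'D_(0, 1) g (x, s)| < L.
  move=> /andP[s0 sy]; apply: (hd (x, s)); rewrite -ball_normE /= prod_normE /=.
  rewrite gt_max [`|x0 - x|]distrC xd sub0r normrN ger0_norm //=.
  by rewrite (le_lt_trans sy) //; move: yd; rewrite ger0_norm.
have Dh s : 0 <= s <= y ->
    is_derive s (1 : R) (fun z => g (x, z)) ('D_(0, 1) g (x, s)).
  move=> sy; have [Us _] := hb s sy.
  have E : (fun h : R => h^-1 *: ((g \o shift (x, s)) (h *: (0, 1)) - g (x, s))) =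
      (fun h : R => h^-1 *: (((fun z => g (x, z)) \o shift s) (h *: 1) - g (x, s))).
    apply/funext => h /=; congr (_ *: (g _ - _)).
    by congr pair => /=; rewrite ?scaler0 ?add0r.
  apply: DeriveDef.
    by have := dg _ Us; rewrite /derivable E.
  by rewrite /derive E.
have [||c] := @MVT_segment R (fun z => g (x, z)) (fun z => 'D_(0, 1) g (x, z)) 0 y y0.
- by move=> z; rewrite in_itv /= => /andP[z0 zy]; apply: Dh; rewrite !ltW.
- apply: derivable_within_continuous => z; rewrite in_itv /= => zy.
  by case: (Dh z zy).
rewrite in_itv /= => cy E.
have [|Uy _] := hb y; first by rewrite y0 lexx.
have [|Ux _] := hb 0; first by rewrite lexx.
have Sx0 : strip p eta (x, 0) by apply: (@strip_down _ p eta x y); rewrite ?y0 ?lexx.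
move: E; rewrite (gV _ Uy Sa) (gV _ Ux Sx0) V2_bottom // !subr0 => ->.
by rewrite normrM (ger0_norm y0) ler_wpM2r // ltW //; case: (hb c cy).
Qed.

Lemma Opt_strip k : (0 < k < p)%N -> strip p eta (Opt R p k).
Proof.
move=> /andP[k0 kp]; have p0 : 0 < p%:R :> R by rewrite ltr0n (leq_trans k0) // ltnW.
apply: Or31 => /=; rewrite lexx ler01; split => //; apply/andP; split.
  by rewrite ler_pdivlMr // mulVf ?gt_eqF // ler1n.
rewrite ler_pdivrMr // mulrBl mul1r mulVf ?gt_eqF // lerBrDr natr1 ler_nat //.
Qed.

(* [V] is not Lipschitz at [Opt R p k], but [u = y + (x - k / p) ^ 2] satisfies
   [u' <= C * u] near it: the first component of [V] is [l * sqrt u] there, and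
   the second one is at most [L * y]. *)
Lemma flow_Opt_near k : (0 < k < p)%N ->
  exists2 d, 0 < d & forall t, 0 <= t <= d -> phi t (Opt R p k) = Opt R p k.
Proof.
move=> kp; have SO := Opt_strip kp.
have [l [l0 hl]] := model_saddle hV kp.
have [L [d [L0 d0 hL]]] := V2_lipschitz_bottom SO.
have p0 : 0 < p%:R :> R by rewrite ltr0n; apply: leq_trans p2.
(* Short times keep the orbit both where the bound by [L * y] holds and in the zone where the square
   root formula holds. *)
have m0 : 0 < Num.min d (8^-1 / p%:R) by rewrite lt_min d0 divr_gt0.
have [d1 d10 hd1] := flow_near_id p2 heta hphi m0.
pose C := L + 2 * l.
have C0 : 0 < C by rewrite addr_gt0 // mulr_gt0.
pose x t := (phi t (Opt R p k)).1; pose y t := (phi t (Opt R p k)).2.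
pose x0 : R := k%:R / p%:R.
pose u t := y t + (x t - x0) ^+ 2.
pose X t := (V (phi t (Opt R p k))).1; pose Y t := (V (phi t (Opt R p k))).2.
have y0 t : 0 <= y t by apply: (@strip_ge0 _ p eta); exact: (flow_strip hphi).
have u0 t : 0 <= u t by rewrite addr_ge0 // sqr_ge0.
have Du t : is_derive t (1 : R) u (Y t + 2 * (x t - x0) * X t).
  have Dx : is_derive t (1 : R) x (X t) := flow1_is_derive hphi t SO.
  have Dy : is_derive t (1 : R) y (Y t) := flow2_is_derive hphi t SO.
  rewrite /u; apply: is_derive_eq.
  by rewrite /GRing.scale /=; ring.
(* Since [x - x0 <= sqrt u] and [X = l * sqrt u], the term [2 * (x - x0) * X] is at most
   [2 * l * u]; the other one is at most [L * y <= L * u]. *)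
have Cu t : 0 <= t <= d1 -> Y t + 2 * (x t - x0) * X t <= C * u t.
  move=> /andP[t0 td]; have := hd1 _ t SO; rewrite ger0_norm // => /(_ td) [].
  rewrite /= subr0 !lt_min => /andP[x1 x2] /andP[y1 y2].
  have ST := flow_strip hphi t SO.
  have Yt : Y t <= L * y t by apply: le_trans (ler_norm _) _; exact: hL.
  have Xt : X t = l * Num.sqrt (u t).
    apply: hl => //; move: x2; rewrite ltr_norml => /andP[x3 x4].
    have aux (z w v : R) : - v < w - z -> w - z < v -> z - v <= w <= z + v by lra.
    by rewrite !mulrDl mulNr; exact: aux.
  have xs : x t - x0 <= Num.sqrt (u t).
    apply: le_trans (ler_norm _) _; rewrite -sqrtr_sqr ler_sqrt //.
    by rewrite /u lerDr.
  have su : Num.sqrt (u t) * Num.sqrt (u t) = u t by rewrite -expr2 sqr_sqrtr.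
  have s0 : 0 <= Num.sqrt (u t) by rewrite sqrtr_ge0.
  have yu : y t <= u t by rewrite /u lerDl sqr_ge0.
  have : (x t - x0) * Num.sqrt (u t) <= u t by rewrite -{2}su ler_wpM2r.
  rewrite Xt /C => xsu; nra.
(* A Gronwall argument: for times up to [1 / (2 * C)], the maximum of [u] satisfies
   [u c <= C * u c * c <= u c / 2], hence is 0. *)
exists (Num.min d1 (2 * C)^-1); first by rewrite lt_min d10 invr_gt0 mulr_gt0.
move=> t /andP[t0]; rewrite le_min => /andP[td tC].
have cu : continuous u by exact: is_derive_continuous Du.
have [c cT hc] := @EVT_max R u 0 t t0 (continuous_subspaceT cu).
move: (cT); rewrite in_itv /= => /andP[c0 ct].
have [|z zc] := @MVT_segment R u _ 0 c c0 (fun t _ => Du t).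
  exact: continuous_subspaceT.
have u00 : u 0 = 0 by rewrite /u /y /x (flow_0 hphi) //= subrr expr0n addr0.
move: zc; rewrite in_itv /= => /andP[z0 zc]; rewrite u00 !subr0 => E.
have uz : u z <= u c by apply: hc; rewrite in_itv /= z0 (le_trans zc).
have zd : 0 <= z <= d1 by rewrite z0 (le_trans zc) // (le_trans ct).
have Cc : C * c <= 2^-1.
  have := le_trans ct tC; rewrite -[(2 * C)^-1]mul1r ler_pdivlMr ?mulr_gt0 //; lra.
have uc0 : u c <= 0.
  have := Cu z zd; have := u0 c; have := u0 z => *.
  have : u c <= C * u c * c by rewrite {1}E; apply: ler_wpM2r => //; nra.
  nra.
have ut0 : u t <= 0.
  by apply: le_trans uc0; apply: hc; rewrite in_itv /= t0 lexx.
have yt0 : y t = 0.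
  by apply/eqP; rewrite eq_le y0 andbT; apply: le_trans ut0; rewrite lerDl sqr_ge0.
have xt0 : (x t - x0) ^+ 2 = 0.
  by apply/eqP; rewrite eq_le sqr_ge0 andbT; move: ut0; rewrite /u yt0 add0r.
rewrite (surjective_pairing (phi t _)) -/(x t) -/(y t) yt0.
by move/eqP : xt0; rewrite sqrf_eq0 subr_eq0 => /eqP ->.
Qed.

(** A positive time is split into steps of length at most [d]; negative times follow by inverting
    the flow. *)
Lemma flow_Opt k t : (0 < k < p)%N -> phi t (Opt R p k) = Opt R p k.
Proof.
move=> kp; have SO := Opt_strip kp.
have [d d0 hd] := flow_Opt_near kp.
have pos s : 0 <= s -> phi s (Opt R p k) = Opt R p k.
  move=> s0; pose n := Num.bound (s / d).
  have nd : s / d < n%:R by apply/archi_boundP/divr_ge0/ltW.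
  have n0 : 0 < n%:R :> R by apply: le_lt_trans nd; apply: divr_ge0 => //; exact: ltW.
  have hsn : phi (s / n%:R) (Opt R p k) = Opt R p k.
    apply: hd; rewrite divr_ge0 ?ler0n //= ler_pdivrMr // mulrC -ler_pdivrMr //.
    exact: ltW.
  suff /(_ n) : forall m, phi (m%:R * (s / n%:R)) (Opt R p k) = Opt R p k.
    by rewrite mulrC divfK // gt_eqF.
  elim=> [|m IH]; first by rewrite mul0r (flow_0 hphi).
  by rewrite -natr1 mulrDl mul1r (flow_add hphi) // hsn.
have [t0|t0] := leP 0 t; first exact: pos.
by rewrite -{1}(pos (- t)) ?oppr_ge0 ?ltW // (@flowK _ p eta V).
Qed.

End saddles.

(** * Lower bound *)

Lemma euclid_dist_ge1 (R : realType) (a b : R * R) :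
  `|a.1 - b.1| <= euclid_dist a b.
Proof. by rewrite -sqrtr_sqr ler_sqrt ?addr_ge0 ?sqr_ge0 // lerDl sqr_ge0. Qed.

Lemma euclid_dist_le (R : realType) (a b : R * R) :
  euclid_dist a b <= `|a.1 - b.1| + `|a.2 - b.2|.
Proof.
have h : 0 <= `|a.1 - b.1| + `|a.2 - b.2| by rewrite addr_ge0.
rewrite -[leRHS]ger0_norm // -sqrtr_sqr ler_sqrt ?sqr_ge0 //.
rewrite [leRHS]sqrrD !real_normK ?num_real // lerD2r lerDl.
by apply/mulrn_wge0/mulr_ge0.
Qed.

(** A ball of radius [e] holds at most one of the points [c i], so choosing for each a ball that
    contains it is injective. Abscissas suffice, as they bound the Euclidean distance from below. *)
Lemma covering_number_ge (R : realType) (A : set (R * R)) (f : R * R -> R * R)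
    (n : nat) (e : R) (I : finType) (c : I -> R * R) :
  (forall i, A (c i)) ->
  (forall i j, i != j -> exists2 k, (k < n)%N &
     2 * e <= `|(iter k f (c i)).1 - (iter k f (c j)).1|) ->
  ((#|I|%:R)%:E <= covering_number (@euclid_dist R) A f n e)%E.
Proof.
move=> Ac sep; apply: le_ereal_inf_tmp => _ [m [b [Ab cov]] <-].
rewrite lee_fin ler_nat.
pose g i := projT1 (cid (cov (c i) (Ac i))).
have hg i : bowen_dist (@euclid_dist R) f n (b (g i)) (c i) < e.
  exact: projT2 (cid (cov (c i) (Ac i))).
have gx i k : (k < n)%N ->
    `|(iter k f (b (g i))).1 - (iter k f (c i)).1| < e.
  move=> kn; apply: le_lt_trans (hg i); apply: le_trans (euclid_dist_ge1 _ _) _.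
  exact: (@bigmax_sup _ _ _ 0 (Ordinal kn)).
rewrite -[leqRHS]card_ord; apply: (@leq_card _ _ g) => i j gij.
apply/eqP/negPn/negP => /sep[k kn]; rewrite leNgt => /negP; apply.
rewrite mulr_natl mulr2n.
apply: le_lt_trans (ler_distD (iter k f (b (g i))).1 _ _) _.
by apply: ltrD; [rewrite distrC|rewrite {1}gij]; exact: gx.
Qed.

Section lower.
Context {R : realType} (p : nat) (eta : R -> R) (V : R * R -> R * R)
  (phi : R -> R * R -> R * R).
Hypothesis p2 : (2 <= p)%N.
Hypothesis heta : profile p eta.
Hypothesis hV : asymptotic_model p eta V.
Hypothesis hphi : global_flow p eta V phi.

Let homo a s t := @flow1_homo R p eta V phi p2 hV hphi a s t.

Lemma iter_flow a n : strip p eta a -> iter n (phi 1) a = phi n%:R a.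
Proof.
move=> Sa; elim: n => [|n IH]; first by rewrite /= (flow_0 hphi).
by rewrite iterS IH (flowD hphi) // addrC natr1.
Qed.

(** Here the vertical through [a] may carry a zero of [V], as it does above a saddle. One unit of
    time moves the orbit strictly past it; then either [c] is already passed or [flow1_reaches]
    applies. *)
Lemma flow1_crosses a c : strip p eta a -> 0 < (V a).1 -> a.1 < c ->
  (forall b, strip p eta b -> a.1 < b.1 <= c -> 0 < (V b).1) ->
  exists2 t, 0 <= t & (phi t a).1 = c.
Proof.
move=> Sa Va ac h; have S1 := flow_strip hphi 1 Sa.
have a1 : a.1 < (phi 1 a).1 by exact: (flow1_gt p2 hV hphi).
have [c1|c1] := leP (phi 1 a).1 c.
  have [|t t0 tc] := flow1_reaches p2 heta hV hphi S1 c1.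
    by move=> b Sb /andP[b1 bc]; apply: h => //; rewrite (lt_le_trans a1 b1).
  by exists (t + 1); [rewrite addr_ge0|rewrite -(flowD hphi)].
have [||t] := @IVT R (fun s => (phi s a).1) 0 1 c ler01.
- by apply: continuous_subspaceT; exact: (flow1_continuous hphi).
- by rewrite (flow_0 hphi) // ge_min (ltW ac) /= le_max (ltW c1) orbT.
by rewrite in_itv /= => /andP[t0 _] <-; exists t.
Qed.

Lemma flow1_crosses_back a c : strip p eta a -> 0 < (V a).1 -> c < a.1 ->
  (forall b, strip p eta b -> c <= b.1 < a.1 -> 0 < (V b).1) ->
  exists2 t, 0 <= t & (phi (- t) a).1 = c.
Proof.
move=> Sa Va ac h; have S1 := flow_strip hphi (- 1) Sa.
have a1 : (phi (- 1) a).1 < a.1 by apply: (flow1_lt p2 hV hphi) => //; rewrite ltrN10.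
have [c1|c1] := leP c (phi (- 1) a).1.
  have [|t t0 tc] := flow1_reaches_back p2 heta hV hphi S1 c1.
    by move=> b Sb /andP[bc b1]; apply: h => //; rewrite bc (le_lt_trans b1 a1).
  by exists (t + 1); [rewrite addr_ge0|rewrite opprD -(flowD hphi)].
have [||t] := @IVT R (fun s => (phi s a).1) (- 1) 0 c (lerN10 _).
- by apply: continuous_subspaceT; exact: (flow1_continuous hphi).
- by rewrite (flow_0 hphi) // ge_min (ltW c1) /= le_max (ltW ac) orbT.
rewrite in_itv /= => /andP[_ t0] <-; exists (- t); rewrite ?opprK //.
by rewrite oppr_ge0.
Qed.

Lemma flow1_vertical_continuous t x y : strip p eta (x, y) ->
  {within `[0, y], continuous (fun z => (phi t (x, z)).1)}.
Proof.
move=> Sxy; apply/subspace_continuousP => z zy.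
have Sz u : u \in `[0, y] -> strip p eta (x, u).
  by rewrite in_itv /= => uy; apply: strip_down Sxy.
have cf : phi t @ within (strip p eta) (nbhs (x, z)) --> phi t (x, z).
  have /subspace_continuousP := @flow_within_continuous _ p eta V phi hphi t.
  by apply; exact: Sz.
have cfst : {for phi t (x, z), continuous (@fst R R)} by exact: cvg_fst.
have h : (fun a => (phi t a).1) @ within (strip p eta) (nbhs (x, z)) -->
  (phi t (x, z)).1 by exact: (continuous_cvg _ cfst cf).
move=> W WW; have [[A B] /= [nA nB] AB] := h W WW; apply: filterS nB => u Bu uy.
apply: (AB (x, u)); last exact: Sz.
by split => //=; exact: nbhs_singleton nA.
Qed.

Lemma mid_abscissa_V1_gt0 (i : nat) b : strip p eta b ->
  (i%:R / p%:R < b.1 < i.+1%:R / p%:R) -> 0 < (V b).1.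
Proof.
move=> Sb /andP[b1 b2]; apply: (V1_gt0 p2 hV) => // k kp E.
have p0 : 0 < p%:R^-1 :> R by rewrite invr_gt0 ltr0n; apply: leq_trans p2.
move: b1 b2; rewrite E /= !ltr_pM2r // !ltr_nat ltnS => ik ki.
by move: (leq_trans ik ki); rewrite ltnn.
Qed.

(** The two sections lie half-way from O_alpha to O_1 and half-way from O_1 to the next fixed point,
    away from the zeros of [V]. *)
Let c1 : R := (2 * p%:R)^-1.
Let c2 : R := 3 * c1.

Let c1_bounds : [/\ 0 < c1, p%:R^-1 = 2 * c1 & 4 * c1 <= 1].
Proof.
have p0 : 0 < p%:R :> R by rewrite ltr0n; apply: leq_trans p2.
have h : p%:R^-1 = 2 * c1 by rewrite /c1 invfM mulrA divff // mul1r.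
split => //; first by rewrite invr_gt0 mulr_gt0.
have /andP[_] := @invp_bound R p p2; rewrite h => ?; lra.
Qed.

Let V1_gt0_section b : strip p eta b ->
  c1 <= b.1 < p%:R^-1 \/ p%:R^-1 < b.1 <= c2 -> 0 < (V b).1.
Proof.
have [c10 pE c14] := c1_bounds.
move=> Sb; rewrite pE /c2 => -[/andP[b1 b2]|/andP[b1 b2]].
  apply: (@mid_abscissa_V1_gt0 0) => //; rewrite mul0r mul1r pE; lra.
apply: (@mid_abscissa_V1_gt0 1) => //; rewrite mul1r pE; lra.
Qed.

Let saddle_vertical_strip y : 0 <= y <= 1 -> strip p eta (p%:R^-1, y).
Proof.
have [c10 pE c14] := c1_bounds; move=> y01; apply: Or31 => /=; split => //.
rewrite pE; lra.
Qed.

Let saddle_vertical_crosses y : 0 < y <= 1 ->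
  (exists2 s, 0 <= s & (phi (- s) (p%:R^-1, y)).1 = c1) /\
  (exists2 t, 0 <= t & (phi t (p%:R^-1, y)).1 = c2).
Proof.
move=> /andP[y0 y1]; have [c10 pE c14] := c1_bounds.
have Sq : strip p eta (p%:R^-1, y) by apply: saddle_vertical_strip; rewrite ltW.
have Vq : 0 < (V (p%:R^-1, y)).1 by exact: (model_right hV).
split.
  apply: flow1_crosses_back => //=; first by rewrite pE; lra.
  by move=> b Sb h; apply: V1_gt0_section => //; left.
apply: flow1_crosses => //=; first by rewrite pE /c2; lra.
by move=> b Sb h; apply: V1_gt0_section => //; right.
Qed.

(** At time [m], a point of [x = c1] on the orbit of (1/p, 1) has reached [c2], and one whose orbit
    passes close to the saddle has not gone beyond it. The intermediate value theorem along the
    section yields arrival at time exactly [m]. *)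
Let transit_times : exists m0 : nat, forall m, (m0 <= m)%N ->
  exists2 b, strip p eta b & b.1 = c1 /\ (phi m%:R b).1 = c2.
Proof.
have [c10 pE c14] := c1_bounds.
have [[s1 s10 hs1] [t1 t10 ht1]] := @saddle_vertical_crosses 1 (ltac:(lra)).
exists (Num.bound (s1 + t1)) => m mm0.
have stm : s1 + t1 <= m%:R.
  apply: (@le_trans _ _ (Num.bound (s1 + t1))%:R); last by rewrite ler_nat.
  by apply/ltW/archi_boundP; rewrite addr_ge0.
have S1 : strip p eta (p%:R^-1, 1) by apply: saddle_vertical_strip; lra.
(* As O_1 is fixed, a point close enough above it is still to the right of [c1] at time [-m], so it
   needs at least [m] to come from [c1]. *)
have [y [y0 y1 hy]] : exists y, [/\ 0 < y, y <= 1 & c1 < (phi (- m%:R) (p%:R^-1, y)).1].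
  have p1 : (0 < 1 < p)%N by rewrite p2.
  have SO : strip p eta (p%:R^-1, 0) by apply: saddle_vertical_strip; lra.
  have O1 : (p%:R^-1, 0) = Opt R p 1 by rewrite /Opt mul1r.
  have := flow1_vertical_continuous (t := - m%:R) S1.
  move=> /subspace_continuousP/(_ 0).
  have i0 : `[(0 : R), 1]%classic 0 by rewrite /= in_itv /= lexx ler01.
  move=> /(_ i0) h.
  have {}h : (fun z => (phi (- m%:R) (p%:R^-1, z)).1) @ within `[(0 : R), 1] (nbhs (0 : R))
      --> (phi (- m%:R) (p%:R^-1, 0)).1 by exact: h.
  have c1p : c1 < (phi (- m%:R) (p%:R^-1, 0)).1.
    by rewrite O1 (flow_Opt p2 heta hV hphi) //= mul1r pE; lra.
  have : \forall z \near within `[(0 : R), 1] (nbhs (0 : R)),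
    c1 < (phi (- m%:R) (p%:R^-1, z)).1 by exact: cvgr_gt h _ c1p.
  rewrite near_withinE => /nbhs_ballP[d /= d0 hd].
  exists (Num.min 1 (d / 2)).
  have y0 : 0 < Num.min 1 (d / 2) by rewrite lt_min ltr01 divr_gt0.
  split => //; first by rewrite ge_min lexx.
  apply: hd; last by rewrite /= in_itv /= (ltW y0) ge_min lexx.
  rewrite -ball_normE /= sub0r normrN gtr0_norm // gt_min; apply/orP; right.
  by rewrite ltr_pdivrMr // ltr_pMr // ltr1n.
have [|[s s0 hs] _] := @saddle_vertical_crosses y; first by rewrite y0.
have Sy : strip p eta (p%:R^-1, y) by apply: saddle_vertical_strip; rewrite ltW.
have sm : m%:R <= s.
  rewrite leNgt; apply/negP => sm; move: hy; rewrite -hs ltNge => /negP; apply.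
  by apply: homo => //; rewrite lerN2 ltW.
pose bl := phi (- s) (p%:R^-1, y); pose bu := phi (- s1) (p%:R^-1, 1).
have Sl : strip p eta bl by exact: (flow_strip hphi).
have Su : strip p eta bu by exact: (flow_strip hphi).
have fl : (phi m%:R (c1, bl.2)).1 <= c2.
  rewrite -hs -surjective_pairing (flowD hphi) //.
  apply: (@le_trans _ _ p%:R^-1); last by rewrite pE /c2; lra.
  rewrite -[leRHS]/((p%:R^-1, y).1) -[in leRHS](flow_0 hphi Sy); apply: homo => //; lra.
have fu : c2 <= (phi m%:R (c1, bu.2)).1.
  rewrite -hs1 -surjective_pairing (flowD hphi) // -ht1.
  by apply: homo => //; lra.
have Sl' : strip p eta (c1, bl.2) by rewrite -hs -surjective_pairing.
have Su' : strip p eta (c1, bu.2) by rewrite -hs1 -surjective_pairing.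
have bl0 := strip_ge0 Sl; have bu0 := strip_ge0 Su.
(* Which of the slow point [bl] and the fast point [bu] is higher is left open, so both orders are
   treated. *)
have [bub|blb] := leP bl.2 bu.2.
  have [||z] := @IVT R (fun z => (phi m%:R (c1, z)).1) bl.2 bu.2 c2 bub.
  - apply: continuous_subspaceW (flow1_vertical_continuous Su').
    by apply: subset_itvr; rewrite bnd_simp.
  - by rewrite ge_min fl /= le_max fu orbT.
  rewrite in_itv /= => /andP[z1 z2] hz; exists (c1, z) => //.
  by apply: strip_down Su'; rewrite z2 (le_trans bl0).
have [||z] := @IVT R (fun z => (phi m%:R (c1, z)).1) bu.2 bl.2 c2 (ltW blb).
- apply: continuous_subspaceW (flow1_vertical_continuous Sl').
  by apply: subset_itvr; rewrite bnd_simp.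
- by rewrite ge_min fl orbT /= le_max fu.
rewrite in_itv /= => /andP[z1 z2] hz; exists (c1, z) => //.
by apply: strip_down Sl'; rewrite z2 (le_trans bu0).
Qed.

(** Being at least one unit of time away from a section costs a definite abscissa; the factor 2 is
    the one in [covering_number_ge]. *)
Let section_displacement : exists2 e, 0 < e & forall b s, strip p eta b ->
  b.1 = c1 \/ b.1 = c2 -> s <= -1 -> (phi s b).1 <= b.1 - 2 * e.
Proof.
have [c10 pE c14] := c1_bounds.
have N10 : -1 != 0 :> R by rewrite oppr_eq0 oner_neq0.
have [|e1 e10 he1] := flow1_displacement p2 heta hV hphi (@closed_strip_itv R c1 c1) _ N10.
  by move=> a Sa /= ac; apply: V1_gt0_section => //; left; rewrite pE; lra.
have [|e2 e20 he2] := flow1_displacement p2 heta hV hphi (@closed_strip_itv R c2 c2) _ N10.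
  by move=> a Sa /= ac; apply: V1_gt0_section => //; right; rewrite pE /c2 in ac *; lra.
have m0 : 0 < Num.min e1 e2 by rewrite lt_min e10.
exists (Num.min e1 e2 / 2); first by rewrite divr_gt0.
move=> b s Sb bc s1; rewrite mulrC divfK //.
apply: (@le_trans _ _ (phi (- 1) b).1); first exact: homo.
have : Num.min e1 e2 <= `|(phi (- 1) b).1 - b.1|.
  case: bc => bc; rewrite ge_min.
    by rewrite he1 //= bc lexx.
  by rewrite he2 ?orbT //= bc lexx.
rewrite ler0_norm; first by move=> ?; lra.
by rewrite subr_le0 -[in leRHS](flow_0 hphi Sb); apply: homo => //; lra.
Qed.

Lemma covering_number_quadratic_lower : exists2 e, 0 < e & exists m0 : nat, forall N,
  (((N * N)%:R)%:E <=
    covering_number (@euclid_dist R) (strip p eta) (phi 1%R) (2 * N + m0) e)%E.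
Proof.
have [m0 hm] := transit_times; have [e e0 he] := section_displacement.
exists e => //; exists m0 => N.
pose b (i : 'I_N) := s2val (cid2 (hm (m0 + i)%N (leq_addr _ _))).
have Sb i : strip p eta (b i) by rewrite /b; case: cid2.
have b1 i : (b i).1 = c1 by rewrite /b; case: cid2 => ? ? [].
have b2 (i : 'I_N) : (phi (m0 + i)%:R (b i)).1 = c2 by rewrite /b; case: cid2 => ? ? [].
(* The first index is the delay before the orbit meets [c1], the second the excess of its transit
   time over [m0]; all crossings used occur before time [2 * N + m0]. *)
pose a (u : 'I_N * 'I_N) := phi (- u.1%:R) (b u.2).
have Sa u : strip p eta (a u) by apply: (flow_strip hphi).
rewrite (_ : (N * N)%N = #|{: 'I_N * 'I_N}|); last by rewrite card_prod card_ord.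
apply: (covering_number_ge (c := a)) => //.
(* Different delays: when the first orbit is on [c1], the other is at least one unit of time short
   of it. *)
have sep1 (u v : 'I_N * 'I_N) : (u.1 < v.1)%N -> exists2 k, (k < 2 * N + m0)%N &
    2 * e <= (iter k (phi 1) (a u)).1 - (iter k (phi 1) (a v)).1.
  move=> uv; exists u.1; first by have := ltn_ord u.1; lia.
  rewrite !iter_flow // /a !(flowD hphi) // addrN (flow_0 hphi) // b1.
  have uv1 : u.1%:R - v.1%:R <= -1 :> R by move: uv; rewrite -(ler_nat R) -natr1; lra.
  by have := he (b v.2) _ (Sb _) (or_introl (b1 _)) uv1; rewrite b1; lra.
(* Equal delays: both meet [c1] together, and when the faster is on [c2] the other still lacks at
   least one unit of time. *)
have sep2 (u v : 'I_N * 'I_N) : u.1 = v.1 -> (u.2 < v.2)%N ->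
    exists2 k, (k < 2 * N + m0)%N &
    2 * e <= (iter k (phi 1) (a u)).1 - (iter k (phi 1) (a v)).1.
  move=> uv uv2; exists (u.1 + (m0 + u.2))%N.
    by have := ltn_ord u.1; have := ltn_ord u.2; lia.
  rewrite !iter_flow // /a !(flowD hphi) // -uv [(u.1 + _)%:R]natrD addrAC addrN add0r b2.
  have uv3 : u.2%:R - v.2%:R <= -1 :> R by move: uv2; rewrite -(ler_nat R) -natr1; lra.
  have := he _ _ (flow_strip hphi (m0 + v.2)%:R (Sb v.2)) (or_intror (b2 _)) uv3.
  rewrite b2 (flowD hphi) //.
  rewrite !natrD (_ : u.2%:R - v.2%:R + (m0%:R + v.2%:R) = m0%:R + u.2%:R); last by ring.
  lra.
have abs k u v : 2 * e <= (iter k (phi 1) (a u)).1 - (iter k (phi 1) (a v)).1 ->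
    2 * e <= `|(iter k (phi 1) (a u)).1 - (iter k (phi 1) (a v)).1|.
  by move=> /le_trans; apply; exact: ler_norm.
move=> u v uv; have [uv1|uv1|uv1] := ltngtP u.1 v.1.
- by have [k kn /abs h] := sep1 _ _ uv1; exists k.
- by have [k kn /abs h] := sep1 _ _ uv1; exists k => //; rewrite distrC.
- have {}uv1 : u.1 = v.1 by exact: val_inj.
  have [uv2|uv2|uv2] := ltngtP u.2 v.2.
  + by have [k kn /abs h] := sep2 _ _ uv1 uv2; exists k.
  + by have [k kn /abs h] := sep2 _ _ (esym uv1) uv2; exists k => //; rewrite distrC.
  + move: uv; rewrite (surjective_pairing u) (surjective_pairing v) uv1.
    by rewrite (val_inj uv2) eqxx.
Qed.

End lower.

(** * Order of the orbits *)

Lemma eq_truncn_dist (R : realType) (M : nat) (x y : R) : (0 < M)%N ->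
  0 <= x -> 0 <= y -> Num.truncn (M%:R * x) = Num.truncn (M%:R * y) ->
  `|x - y| < M%:R^-1.
Proof.
move=> M0 x0 y0 xy; have M0' : 0 < M%:R :> R by rewrite ltr0n.
have /andP[x1 x2] := truncn_itv (mulr_ge0 (ltW M0') x0).
have /andP[y1 y2] := truncn_itv (mulr_ge0 (ltW M0') y0).
rewrite -(ltr_pM2l M0') divff ?gt_eqF // -{1}(gtr0_norm M0') -normrM mulrBr.
rewrite ltr_norml; move: x1 x2; rewrite xy => x1 x2; rewrite -natr1 in x2 y2; lra.
Qed.

(** No term decreases from [x] to [y], so a single strict increase would show in the sum. *)
Lemma eq_sum_homo (I : finType) (T : Type) (r : T -> T -> Prop) (F : I -> T -> nat)
    (x y : T) : (forall i, r x y -> (F i x <= F i y)%N) -> r x y ->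
  (\sum_i F i x = \sum_i F i y)%N -> forall i, F i x = F i y.
Proof.
move=> Fr xy E i; apply/eqP; rewrite eqn_leq Fr //= leqNgt; apply/negP => lti.
have : (\sum_j F j x < \sum_j F j y)%N.
  rewrite (bigD1 i) //= [X in (_ < X)%N](bigD1 i) //= -addSn leq_add //.
  by apply: leq_sum => j _; exact: Fr.
by rewrite E ltnn.
Qed.

Section itineraries.
Context {R : realType} (p : nat) (eta : R -> R) (V : R * R -> R * R)
  (phi : R -> R * R -> R * R).
Hypothesis p2 : (2 <= p)%N.
Hypothesis heta : profile p eta.
Hypothesis hV : asymptotic_model p eta V.
Hypothesis hphi : global_flow p eta V phi.

Let homo a s t := @flow1_homo R p eta V phi p2 hV hphi a s t.

(** The speed vanishes only at fixed points. The bounds on the abscissa exclude O_alpha and O_omega,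
    and an orbit of positive initial height never meets an inner saddle, which the flow fixes in
    both time directions. *)
Lemma flow1_strict a s t : strip p eta a -> 0 < a.1 -> 0 < a.2 -> 0 <= s ->
  (phi s a).1 < 1 -> s < t -> (phi s a).1 < (phi t a).1.
Proof.
move=> Sa a1 a2 s0 s1 st; have Ss := flow_strip hphi s Sa.
have p0 : 0 < p%:R :> R by rewrite ltr0n; apply: leq_trans p2.
have as1 : a.1 <= (phi s a).1 by rewrite -{1}(flow_0 hphi Sa); exact: homo.
rewrite -(subrK s t) -(flowD hphi) //; apply: (flow1_gt p2 hV hphi) => //; last by rewrite subr_gt0.
apply: (V1_gt0 p2 hV) => // k; rewrite leq_eqVlt => /predU1P[->|kp] E.
  by move: s1; rewrite E /= divff ?gt_eqF // ltxx.
have [k0|k0] := posnP k.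
  by move: (lt_le_trans a1 as1); rewrite E k0 /= mul0r ltxx.
have kp' : (0 < k < p)%N by rewrite k0.
have := flowNK hphi s Sa; rewrite E (flow_Opt p2 heta hV hphi) // => aE.
by move: a2; rewrite -aE ltxx.
Qed.

Lemma flow1_inj a s t : strip p eta a -> 0 < a.1 -> 0 < a.2 -> 0 <= s -> 0 <= t ->
  (phi s a).1 < 1 -> (phi s a).1 = (phi t a).1 -> s = t.
Proof.
move=> Sa a1 a2 s0 t0 s1 E; have [st|ts|//] := ltgtP s t.
  by have := flow1_strict Sa a1 a2 s0 s1 st; rewrite E ltxx.
have t1 : (phi t a).1 < 1 by rewrite -E.
by have := flow1_strict Sa a1 a2 t0 t1 ts; rewrite E ltxx.
Qed.

Lemma closed_strip_ge2 (c : R) : closed [set a : R * R | c <= a.2].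
Proof.
apply: (@preimage_closed (R * R)%type R snd [set x | c <= x]).
  by move=> a _; exact: cvg_snd.
exact: closed_ge.
Qed.

(* Changing the height by [e] requires some time spent in [y >= e / 2], a compact set
   without zeros of [V], where the abscissa grows at a definite rate. *)
Lemma flow2_small_displacement e : 0 < e -> exists2 h, 0 < h &
  forall a t, strip p eta a -> 0 <= t -> (phi t a).1 - a.1 < h ->
    `|(phi t a).2 - a.2| < e.
Proof.
move=> e0; have e20 : 0 < e / 2 by rewrite divr_gt0.
have [d d0 hd] := flow_near_id p2 heta hphi e20.
have [||h h0 hh] := flow1_displacement (s := d) p2 heta hV hphi (@closed_strip_ge2 (e / 2)).
- by move=> a Sa /= ae; apply: (model_right hV) => //; exact: lt_le_trans ae.
- by rewrite gt_eqF.
exists h => // a t Sa t0 th; have [td|td] := leP t d.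
  have [|_] := hd a t Sa; first by rewrite ger0_norm.
  by move=> H; apply: lt_trans H _; rewrite ltr_pdivrMr // ltr_pMr // ltr1n.
have St := flow_strip hphi (t - d) Sa.
have disp b : strip p eta b -> e / 2 <= b.2 -> h <= (phi d b).1 - b.1.
  move=> Sb eb; have := hh b Sb eb; rewrite ger0_norm // subr_ge0.
  by rewrite -[in leLHS](flow_0 hphi Sb); apply: homo => //; exact: ltW.
have Et : phi d (phi (t - d) a) = phi t a by rewrite (flowD hphi) // addrC subrK.
(* A rise by [e] forces a height of at least [e / 2] at time [t - d], a fall by [e] forces it at
   time 0; in both cases the next [d] units of time already gain [h]. *)
rewrite ltNge; rewrite ler_normr; apply/negP => /orP[y1|y1].
  have [|_] := hd (phi (t - d) a) d St; first by rewrite gtr0_norm.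
  rewrite Et => H; have a0 := strip_ge0 Sa.
  have := disp _ St; rewrite Et => H2.
  have {}H2 : h <= (phi t a).1 - (phi (t - d) a).1.
    by apply: H2; move: H; rewrite ltr_norml; lra.
  have : a.1 <= (phi (t - d) a).1.
    by rewrite -{1}(flow_0 hphi Sa); apply: homo => //; rewrite subr_ge0 ltW.
  lra.
have H2 := disp a Sa.
have {}H2 : h <= (phi d a).1 - a.1.
  by apply: H2; have := strip_ge0 (flow_strip hphi t Sa); lra.
have : (phi d a).1 <= (phi t a).1 by apply: homo => //; exact: ltW.
lra.
Qed.

(** An orbit of positive initial height is a graph over its abscissa: [g] is the continuous inverse
    of a strictly increasing function of time. *)
Let inverse_time a s : strip p eta a -> 0 < a.1 -> 0 < a.2 -> 0 <= s ->
  (phi s a).1 < 1 -> exists g : R -> R,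
  [/\ {within `[a.1, (phi s a).1], continuous g},
      forall u, u \in `[a.1, (phi s a).1] -> 0 <= g u /\ (phi (g u) a).1 = u &
      forall t, 0 <= t <= s -> g (phi t a).1 = t].
Proof.
move=> Sa a1 a2 s0 s1.
pose P u := [set t | 0 <= t <= s /\ (phi t a).1 = u].
pose g u := xget 0 (P u).
have gK t : 0 <= t <= s -> g (phi t a).1 = t.
  move=> ts; have /andP[t0 t1] := ts; have Pt : P (phi t a).1 t by [].
  have [/andP[g0 g1] gt] : P (phi t a).1 (g (phi t a).1) by apply: xgetPex; exists t.
  apply: (flow1_inj Sa a1 a2) => //; rewrite gt.
  by apply: le_lt_trans s1; exact: homo.
have cx : continuous (fun s => (phi s a).1) by exact: (flow1_continuous hphi).
exists g; split => //.
  have gK' : {in `[0, s], cancel (fun s => (phi s a).1) g}.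
    by move=> t; rewrite in_itv /=; exact: gK.
  have := segment_can_le_continuous s0 (continuous_subspaceT cx) gK'.
  by rewrite /= (flow_0 hphi).
move=> u; rewrite in_itv /= => /andP[u0 u1].
have [||t] := @IVT R (fun s => (phi s a).1) 0 s u s0.
- exact: continuous_subspaceT.
- by rewrite (flow_0 hphi) // ge_min u0 /= le_max u1 orbT.
rewrite in_itv /= => ts tu; have Pt : P u t by [].
by have [/andP[g0 g1] gt] : P u (g u) by apply: xgetPex; exists t.
Qed.

(** Otherwise the difference of heights, as a function of the abscissa, would change sign and the
    orbits would meet. Both starting points would then lie on one orbit at the same abscissa [w],
    against [flow1_inj]. *)
Lemma orbits_do_not_cross w y1 y2 s1 s2 : 0 < w -> 0 < y1 < y2 ->
  strip p eta (w, y1) -> strip p eta (w, y2) -> 0 <= s1 -> 0 <= s2 ->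
  (phi s1 (w, y1)).1 = (phi s2 (w, y2)).1 -> (phi s1 (w, y1)).1 < 1 ->
  (phi s1 (w, y1)).2 <= (phi s2 (w, y2)).2.
Proof.
move=> w0 /andP[y10 y12] S1 S2 s10 s20 E lt1; have y20 := lt_trans y10 y12.
rewrite leNgt; apply/negP => lty.
have lt2 : (phi s2 (w, y2)).1 < 1 by rewrite -E.
have [g1 [cg1 g1K g1s]] := inverse_time S1 w0 y10 s10 lt1.
have [g2 [cg2 g2K g2s]] := inverse_time S2 w0 y20 s20 lt2.
have /= wv := homo S1 s10; rewrite (flow_0 hphi) //= in wv.
rewrite -E /= in cg2 g2K; rewrite /= in cg1 g1K.
pose D u := (phi (g2 u) (w, y2)).2 - (phi (g1 u) (w, y1)).2.
have cD : {within `[w, (phi s1 (w, y1)).1], continuous D}.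
  have c i y g : strip p eta (w, y) -> {within i, continuous g} ->
      {within i, continuous (fun u => (phi (g u) (w, y)).2)}.
    move=> S cg; apply: (@within_continuous_comp _ _ _ i g (fun t => (phi t (w, y)).2)) => //.
    by move=> z _; exact: (flow2_continuous hphi).
  have h1 := c _ _ _ _ S1 cg1; have h2 := c _ _ _ _ S2 cg2.
  move=> u; apply: cvgB; [exact: h2|exact: h1].
have g10 : g1 w = 0.
  by have := g1s 0; rewrite (flow_0 hphi) //= => ->//; rewrite lexx.
have g20 : g2 w = 0.
  by have := g2s 0; rewrite (flow_0 hphi) //= => ->//; rewrite lexx.
have [|u uwv Du] := @IVT R D w (phi s1 (w, y1)).1 0 wv cD.
  rewrite /D g10 g20 !(flow_0 hphi) //= g1s ?lexx ?s10 // [in g2 _]E g2s ?lexx ?s20 //.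
  by rewrite ge_min le_max !subr_le0 !subr_ge0 (ltW lty) (ltW y12) orbT.
have [t10 e1] := g1K u uwv; have [t20 e2] := g2K u uwv.
set t1 := g1 u in t10 e1; set t2 := g2 u in t20 e2.
have Et : phi t1 (w, y1) = phi t2 (w, y2).
  rewrite [LHS]surjective_pairing [RHS]surjective_pairing e1 e2; congr pair.
  by apply/eqP; rewrite eq_sym -subr_eq0 -Du.
have w1 : w < 1 by apply: le_lt_trans lt1.
have same y (S : strip p eta (w, y)) t : 0 < y -> 0 <= t -> (phi t (w, y)).1 = w -> t = 0.
  move=> y0 t0 tw; apply/esym/(flow1_inj S) => //; first by rewrite (flow_0 hphi).
  by rewrite (flow_0 hphi) //= tw.
have F2 : (w, y2) = phi (t1 - t2) (w, y1).
  by rewrite -[LHS](flowNK hphi t2 S2) -Et (flowD hphi) // addrC.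
have F1 : (w, y1) = phi (t2 - t1) (w, y2).
  by rewrite -[LHS](flowNK hphi t1 S1) Et (flowD hphi) // addrC.
(* Its sign decides which starting point is in the future of the other. *)
have t12 : t1 - t2 = 0.
  have [h|h] := leP 0 (t1 - t2); first by apply: (same y1 S1) => //; rewrite -F2.
  by apply/oppr_inj; rewrite oppr0 opprB; apply: (same y2 S2) => //; rewrite -?F1 //; lra.
by move: F2 y12; rewrite t12 (flow_0 hphi) // => -[->]; rewrite ltxx.
Qed.

End itineraries.

(** * Upper bound *)

Lemma inv_natr_lt (R : realType) (x : R) : 0 < x ->
  exists2 M : nat, (0 < M)%N & M%:R^-1 < x.
Proof.
move=> x0; exists (Num.bound x^-1).+1 => //.
rewrite invf_plt ?posrE //; apply: lt_le_trans (archi_boundP _) _.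
  by rewrite invr_ge0 ltW.
by rewrite ler_nat.
Qed.

(** One representative per key serves as centre. [G] is a relation, so that a point on the border of
    two cells may have several keys. *)
Lemma covering_number_le (R : realType) (T : choiceType) (d : T -> T -> R) (A : set T)
    (f : T -> T) (n : nat) (e : R) (K : finType) (G : T -> K -> Prop) (a0 : T) :
  A a0 -> 0 < e -> (forall a, A a -> exists k, G a k) ->
  (forall a b k, A a -> A b -> G a k -> G b k ->
     forall m, (m < n)%N -> d (iter m f a) (iter m f b) < e) ->
  (covering_number d A f n e <= (#|K|%:R)%:E)%E.
Proof.
move=> Aa0 e0 hG hd; apply: ge_ereal_inf; exists (#|K|%:R)%:E => //.
exists #|K| => //.
(* Centres must lie in [A], so a key held by no point gets the default [a0]. *)
pose c (i : 'I_#|K|) := xget a0 [set a | A a /\ G a (enum_val i)].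
have Ac i : A (c i).
  by rewrite /c; case: xgetP => [a _ []|].
exists c; split => // a Aa; have [k Gk] := hG a Aa.
exists (enum_rank k); apply/bigmax_ltP; split => // m _.
have [Ac' Gc] : A (c (enum_rank k)) /\ G (c (enum_rank k)) k.
  rewrite /c enum_rankK; apply: (@xgetPex _ a0 [set a | A a /\ G a k]).
  by exists a.
exact: hd Gc Gk _ (ltn_ord m).
Qed.

(** The left side counts pairs of a rounded exit time and a code, plus one for the absence of exit;
    both factors are linear in [n]. *)
Lemma key_count_le (M N E n : nat) :
  ((((n * N).+1 * (((n * N).+1 + M) * E).+2).+1 <=
   (N.+1 * ((N.+1 + M) * E + 2) + 1) * (n.+1 * n.+1)))%N.
Proof.
have h1 : ((n * N).+1 <= N.+1 * n.+1)%N by rewrite mulSn mulnS; lia.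
have h2 : (((n * N).+1 + M) * E <= (N.+1 + M) * E * n.+1)%N.
  by rewrite mulnAC leq_mul2r mulnDl (leq_add h1) ?orbT // leq_pmulr.
have h3 : ((((n * N).+1 + M) * E).+2 <= ((N.+1 + M) * E + 2) * n.+1)%N.
  by rewrite [leqRHS]mulnDl; lia.
rewrite [leqRHS]mulnDl mul1n -addn1 leq_add ?muln_gt0 //.
by apply: leq_trans (leq_mul h1 h3) _; rewrite mulnACA.
Qed.

Section upper.
Context {R : realType} (p : nat) (eta : R -> R) (V : R * R -> R * R)
  (phi : R -> R * R -> R * R).
Hypothesis p2 : (2 <= p)%N.
Hypothesis heta : profile p eta.
Hypothesis hV : asymptotic_model p eta V.
Hypothesis hphi : global_flow p eta V phi.
Hypothesis htorsion : torsion p eta phi.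

Let homo a s t := @flow1_homo R p eta V phi p2 hV hphi a s t.

Let flow1_bounds t a : strip p eta a -> 0 <= (phi t a).1 <= 1.
Proof. by move=> Sa; apply: (strip_itv p2 (eta := eta)); exact: (flow_strip hphi). Qed.

Let flow2_ge0 t a : strip p eta a -> 0 <= (phi t a).2.
Proof. by move=> Sa; apply: (strip_ge0 (p := p) (eta := eta)); exact: (flow_strip hphi). Qed.

(* Torsion makes the position at a given time nondecreasing in the height of
   the starting point, and so is the height at a given abscissa since orbits do
   not cross.  A sum of nondecreasing functions determines its terms, so a whole
   itinerary is encoded by a number which is linear in its length. *)
Lemma itinerary_code (M N n Y : nat) (w : R) : (0 < M)%N ->
  (forall a, strip p eta a -> a.2 <= Y%:R) -> 0 < w < 1 ->
  exists S : R -> nat,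
  (forall y, 0 < y -> strip p eta (w, y) ->
     (S y <= (n.+1 + M) * (M + (M * Y).+1))%N) /\
  forall y y', 0 < y -> 0 < y' -> strip p eta (w, y) -> strip p eta (w, y') ->
    S y = S y' ->
    (forall r : nat, (r <= n)%N ->
       Num.truncn (M%:R * (phi (r%:R / N%:R) (w, y)).1) =
       Num.truncn (M%:R * (phi (r%:R / N%:R) (w, y')).1)) /\
    (forall (l : nat) s s', (l < M)%N -> 0 <= s -> 0 <= s' ->
       (phi s (w, y)).1 = l%:R / M%:R -> (phi s' (w, y')).1 = l%:R / M%:R ->
       `|(phi s (w, y)).2 - (phi s' (w, y')).2| < M%:R^-1).
Proof.
move=> M0 hY /andP[w0 w1]; have M0' : 0 < M%:R :> R by rewrite ltr0n.
pose reaches (l : nat) y := exists2 s, 0 <= s & (phi s (w, y)).1 = l%:R / M%:R.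
(* The value 0 marks a vertical never reached; the successor sets the others apart, so the function
   stays nondecreasing as higher orbits reach more verticals. *)
pose height (l : nat) y : nat := if pselect (reaches l y) is left h
  then (Num.truncn (M%:R * (phi (s2val (cid2 h)) (w, y)).2)).+1 else 0.
have heightE (l : nat) y s : (l < M)%N -> 0 < y -> strip p eta (w, y) -> 0 <= s ->
    (phi s (w, y)).1 = l%:R / M%:R ->
    height l y = (Num.truncn (M%:R * (phi s (w, y)).2)).+1.
  move=> lM y0 Sy s0 sl; rewrite /height; case: pselect => [h|[]]; last by exists s.
  case: cid2 => s' s'0 /= s'l; rewrite (@flow1_inj R p eta V phi p2 heta hV hphi (w, y) s' s) //.
    by rewrite s'l ltr_pdivrMr // mul1r ltr_nat.
  by rewrite s'l sl.
pose F (i : 'I_n.+1 + 'I_M) y : nat := match i with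
  | inl r => Num.truncn (M%:R * (phi (r%:R / N%:R) (w, y)).1)
  | inr l => height l y end.
pose lt y y' := [/\ 0 < y, y < y', strip p eta (w, y) & strip p eta (w, y')].
have Fhomo i y y' : lt y y' -> (F i y <= F i y')%N.
  move=> [y0 yy' Sy Sy']; have y'0 := lt_trans y0 yy'.
  have [| |||tor _] := htorsion (x := w) (y1 := y) (y2 := y'); rewrite ?w0 ?y0 //.
  case: i => [r|l] /=.
    by apply: le_truncn; rewrite ler_pM2l // tor // divr_ge0.
  have [[s s0 sl]|nr] := pselect (reaches l y); last by rewrite /height; case: pselect.
  rewrite (heightE l y s) //.
  have wl : (phi 0 (w, y')).1 <= l%:R / M%:R.
    by rewrite (flow_0 hphi) //= -sl -[leLHS]/((w, y).1) -[in leLHS](flow_0 hphi Sy); exact: homo.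
  (* By torsion the higher orbit is at least as far at time [s], so it has met the vertical too. *)
  have [||s'] := @IVT R (fun s => (phi s (w, y')).1) 0 s (l%:R / M%:R) s0.
  - by apply: continuous_subspaceT; exact: (flow1_continuous hphi).
  - by rewrite ge_min wl /= le_max -sl tor // orbT.
  rewrite in_itv /= => /andP[s'0 _] s'l.
  rewrite (heightE l y' s') // ltnS; apply: le_truncn; rewrite ler_pM2l //.
  apply: (orbits_do_not_cross p2 heta hV hphi) => //; rewrite ?y0 //.
    by rewrite sl s'l.
  by rewrite sl ltr_pdivrMr // mul1r ltr_nat.
exists (fun y => \sum_i F i y)%N; split.
  move=> y y0 Sy; apply: (@leq_trans (\sum_(i : 'I_n.+1 + 'I_M) (M + (M * Y).+1))%N).
    apply: leq_sum => -[r|l] _ /=.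
      apply: leq_trans (leq_addr _ _); rewrite -(ler_nat R).
      have /andP[x0 x1] := flow1_bounds (r%:R / N%:R) Sy.
      have /andP[h _] := truncn_itv (mulr_ge0 (ltW M0') x0).
      by apply: le_trans h _; rewrite ger_pMr.
    apply: leq_trans (leq_addl _ _); rewrite /height; case: pselect => // h; rewrite ltnS.
    have h0 : 0 <= (phi (s2val (cid2 h)) (w, y)).2 by exact: flow2_ge0.
    have /andP[h1 _] := truncn_itv (mulr_ge0 (ltW M0') h0).
    rewrite -(ler_nat R) natrM; apply: le_trans h1 _; rewrite ler_pM2l // hY //.
    exact: (flow_strip hphi).
  by rewrite sum_nat_const card_sum !card_ord.
have Fall y y' i : 0 < y -> 0 < y' -> strip p eta (w, y) -> strip p eta (w, y') ->
    (\sum_i F i y = \sum_i F i y')%N -> F i y = F i y'.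
  move=> y0 y'0 Sy Sy' E; have [yy'|yy'|->//] := ltgtP y y'.
    by apply: (@eq_sum_homo _ _ lt F y y') => // j; exact: Fhomo.
  by apply/esym; apply: (@eq_sum_homo _ _ lt F y' y) => // j; exact: Fhomo.
move=> y y' y0 y'0 Sy Sy' E; split => [r rn|l s s' lM s0 s'0 sl s'l].
  exact: (Fall y y' (inl (Ordinal (rn : r < n.+1)%N))).
have := Fall y y' (inr (Ordinal lM)) y0 y'0 Sy Sy' E.
rewrite /F (heightE _ _ s) // (heightE _ _ s') // => -[].
exact/eq_truncn_dist/flow2_ge0/Sy'/flow2_ge0.
Qed.

Lemma covering_number_quadratic_upper (e : R) : 0 < e -> exists C : nat, forall n,
  (covering_number (@euclid_dist R) (strip p eta) (phi 1%R) n e <=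
     ((C * (n.+1 * n.+1))%:R)%:E)%E.
Proof.
(* The worst error below is [3 * z] in abscissa plus [5 * z] in height, that is, half of [e]. *)
move=> e0; pose z := e / 16; have z0 : 0 < z by rewrite divr_gt0.
have [h h0 hh] := flow2_small_displacement p2 heta hV hphi z0.
have [d d0 hd] := flow_near_id p2 heta hphi z0.
(* Inside a cell of width [1 / M < h] heights change by less than [z], and values with equal
   truncations at scale [M] differ by less than [z]. *)
have [M M0 Mh] : exists2 M : nat, (0 < M)%N & M%:R^-1 < Num.min h z.
  by apply: inv_natr_lt; rewrite lt_min h0.
move: Mh; rewrite lt_min => /andP[Mh Mz].
(* A time of at most [1 / N] moves each coordinate by less than [z], so exit times may be rounded to
   multiples of [1 / N]. *)
have [N N0 Nd] := inv_natr_lt d0.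
have [Y hY] := strip_bounded heta p2.
have M0' : 0 < M%:R :> R by rewrite ltr0n.
have N0' : 0 < N%:R :> R by rewrite ltr0n.
pose D := ((N.+1 + M) * (M + (M * Y).+1) + 2)%N.
exists (M * (M * Y).+1 * (N.+1 * D + 1))%N => n.
pose B := (((n * N).+1 + M) * (M + (M * Y).+1))%N.
(* The right side of cell [i]. For the last cell it is [x = 1], which no orbit passes, whence the
   condition [i.+1 < M] on exits. *)
pose w (i : nat) : R := i.+1%:R / M%:R.
have wE i : w i = i%:R / M%:R + M%:R^-1 by rewrite /w -natr1 mulrDl mul1r.
have hS (i : 'I_M) : exists S : R -> nat, (i.+1 < M)%N ->
  (forall y, 0 < y -> strip p eta (w i, y) -> (S y <= B)%N) /\
  forall y y', 0 < y -> 0 < y' -> strip p eta (w i, y) -> strip p eta (w i, y') ->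
    S y = S y' ->
    (forall r : nat, (r <= n * N)%N ->
       Num.truncn (M%:R * (phi (r%:R / N%:R) (w i, y)).1) =
       Num.truncn (M%:R * (phi (r%:R / N%:R) (w i, y')).1)) /\
    (forall (l : nat) s s', (l < M)%N -> 0 <= s -> 0 <= s' ->
       (phi s (w i, y)).1 = l%:R / M%:R -> (phi s' (w i, y')).1 = l%:R / M%:R ->
       `|(phi s (w i, y)).2 - (phi s' (w i, y')).2| < M%:R^-1).
  have [iM|iM] := ltnP i.+1 M; last by exists (fun=> 0%N).
  have wi : 0 < w i < 1 by rewrite divr_gt0 //= ltr_pdivrMr // mul1r ltr_nat.
  by have [S HS] := itinerary_code N (n * N) M0 hY wi; exists S.
have {hS} [S hS] := choice hS.
pose K := ('I_M * 'I_(M * Y).+1 * option ('I_(n * N).+1 * 'I_B.+2))%type.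
(* [i] is the grid cell of the abscissa of [a], [q] that of its height, [j] the
   time at which the orbit of [a] leaves the cell [i], and [s] the code of the
   itinerary after that time; [s = 0] when the orbit leaves through [y = 0]. *)
pose G (a : R * R) (k : K) := let: (i, q, o) := k in
  [/\ i%:R / M%:R <= a.1 <= w i, Num.truncn (M%:R * a.2) = q &
  match o with
  | None => forall t, 0 <= t <= n%:R -> (phi t a).1 <= w i
  | Some (j, s) => (i.+1 < M)%N /\ exists t y,
     [/\ j%:R / N%:R <= t <= j.+1%:R / N%:R, phi t a = (w i, y) &
       (y = 0 /\ s = 0%N :> nat) \/ (0 < y /\ s = (S i y).+1 :> nat)]
  end].
have S00 : strip p eta (Opt R p 1) by apply: Opt_strip.
have cardK : (#|{: K}| <= M * (M * Y).+1 * (N.+1 * D + 1) * (n.+1 * n.+1))%N.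
  rewrite !card_prod card_option card_prod !card_ord -[leqRHS]mulnA leq_mul2l.
  apply/orP; right.
  exact: key_count_le.
(* Abscissas never decrease, so before its exit the orbit stays in the cell and its height is nearly
   constant. *)
have near_start i q o a t : strip p eta a -> G a (i, q, o) -> 0 <= t ->
    (phi t a).1 <= w i -> i%:R / M%:R <= (phi t a).1 /\ `|(phi t a).2 - a.2| < z.
  move=> Sa [/andP[ia _] _ _] t0 tw.
  have at1 : a.1 <= (phi t a).1 by rewrite -{1}(flow_0 hphi Sa); exact: homo.
  split; first exact: le_trans at1.
  by apply: hh => //; rewrite wE in tw; lra.
have before i q o a b t : strip p eta a -> strip p eta b -> G a (i, q, o) ->
    G b (i, q, o) -> 0 <= t -> (phi t a).1 <= w i -> (phi t b).1 <= w i ->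
    euclid_dist (phi t a) (phi t b) < e.
  move=> Sa Sb Ga Gb t0 aw bw.
  have [a1 a2] := near_start _ _ _ _ _ Sa Ga t0 aw.
  have [b1 b2] := near_start _ _ _ _ _ Sb Gb t0 bw.
  have ab : `|a.2 - b.2| < M%:R^-1.
    case: Ga Gb => _ qa _ [_ qb _]; apply: eq_truncn_dist => //; last by rewrite qa qb.
      exact: strip_ge0 Sa.
    exact: strip_ge0 Sb.
  apply: le_lt_trans (euclid_dist_le _ _) _.
  have h1 : `|(phi t a).1 - (phi t b).1| <= z.
    by rewrite wE in aw bw; rewrite ler_norml; lra.
  have h2 : `|(phi t a).2 - (phi t b).2| <= 3 * z.
    by move: a2 b2 ab; rewrite !ltr_norml ler_norml; lra.
  rewrite /z in h1 h2; lra.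
have after (i : 'I_M) y y' (r : nat) : (i.+1 < M)%N -> 0 < y -> 0 < y' ->
    strip p eta (w i, y) -> strip p eta (w i, y') -> S i y = S i y' ->
    (r <= n * N)%N ->
    `|(phi (r%:R / N%:R) (w i, y)).1 - (phi (r%:R / N%:R) (w i, y')).1| < z /\
    `|(phi (r%:R / N%:R) (w i, y)).2 - (phi (r%:R / N%:R) (w i, y')).2| < 3 * z.
  move=> iM y0 y'0 Sy Sy' E rn.
  have [_ /(_ y y' y0 y'0 Sy Sy' E)[/(_ r rn) Er El]] := hS i iM.
  have r0 : 0 <= r%:R / N%:R :> R by rewrite divr_ge0.
  move: (r%:R / N%:R) r0 Er => th th0 Er.
  have xb u : strip p eta (w i, u) -> w i <= (phi th (w i, u)).1 <= 1.
    move=> Su; have /andP[_ ->] := flow1_bounds th Su; rewrite andbT.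
    by rewrite -[leLHS]/((w i, u).1) -[in leLHS](flow_0 hphi Su); exact: homo.
  have /andP[wx x1] := xb y Sy; have /andP[wx' x1'] := xb y' Sy'.
  have w0 : 0 < w i by rewrite divr_gt0.
  split.
    apply: lt_trans Mz; apply: eq_truncn_dist => //.
      exact: le_trans (ltW w0) wx.
    exact: le_trans (ltW w0) wx'.
  (* The last grid vertical met, capped at [M - 1] since the abscissa may be 1. Each height is
     within [z] of its value on that vertical, and equal codes put these two values within [z]: the
     total is [3 * z]. *)
  pose l := minn (Num.truncn (M%:R * (phi th (w i, y)).1)) M.-1.
  have lM : (l < M)%N by rewrite /l gtn_min ltn_predL M0 orbT.
  have lx u : strip p eta (w i, u) ->
      l = minn (Num.truncn (M%:R * (phi th (w i, u)).1)) M.-1 ->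
      exists s, [/\ 0 <= s, (phi s (w i, u)).1 = l%:R / M%:R &
        `|(phi th (w i, u)).2 - (phi s (w i, u)).2| < z].
    move=> Su lE; have /andP[wu u1] := xb u Su.
    have Mu : 0 <= M%:R * (phi th (w i, u)).1.
      by apply: mulr_ge0 => //; exact: le_trans (ltW w0) wu.
    have /andP[l1 l2] := truncn_itv Mu.
    have wl : w i <= l%:R / M%:R.
      rewrite ler_pM2r ?invr_gt0 // ler_nat lE leq_min.
      apply/andP; split; last by rewrite -ltnS prednK.
      by rewrite truncn_ge_nat // mulrC -ler_pdivrMr.
    have lu : l%:R / M%:R <= (phi th (w i, u)).1.
      rewrite ler_pdivrMr // mulrC; apply: le_trans l1; by rewrite ler_nat lE geq_minl.
    have ul : (phi th (w i, u)).1 - l%:R / M%:R <= M%:R^-1.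
      rewrite lerBlDl (_ : _ + _ = l.+1%:R / M%:R); last by rewrite -natr1 mulrDl mul1r.
      rewrite ler_pdivlMr // mulrC.
      have [tM|tM] := leqP (Num.truncn (M%:R * (phi th (w i, u)).1)) M.-1.
        by apply: le_trans (ltW l2) _; rewrite lE (minn_idPl tM).
      rewrite lE (minn_idPr (ltnW tM)) prednK //.
      by rewrite -[leRHS]mulr1 ler_pM2l.
    have [||s] := @IVT R (fun s => (phi s (w i, u)).1) 0 th (l%:R / M%:R) th0.
    - by apply: continuous_subspaceT; exact: (flow1_continuous hphi).
    - by rewrite (flow_0 hphi) // ge_min wl /= le_max lu orbT.
    rewrite in_itv /= => /andP[s0 sth] sl; exists s; split => //.
    have Ss := flow_strip hphi s Su.
    have := hh _ (th - s) Ss; rewrite (flowD hphi) // subrK subr_ge0 sl; apply => //.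
    exact: le_lt_trans ul Mh.
  have [s [s0 sl sz]] := lx y Sy erefl.
  have [|s' [s'0 s'l s'z]] := lx y' Sy'; first by rewrite /l Er.
  have := El l s s' lM s0 s'0 sl s'l.
  move: sz s'z; rewrite !ltr_norml; lra.
apply: le_trans (covering_number_le (K := K) (G := G) S00 e0 _ _) _.
- move=> a Sa; have /andP[a0 a1] := strip_itv p2 Sa.
  have Ma0 : 0 <= M%:R * a.1 by rewrite mulr_ge0.
  have Ma20 : 0 <= M%:R * a.2 by rewrite mulr_ge0 // (strip_ge0 Sa).
  have [i ia] : exists i : 'I_M, i%:R / M%:R <= a.1 <= w i.
    have /andP[l1 l2] := truncn_itv Ma0.
    have [tM|tM] := ltnP (Num.truncn (M%:R * a.1)) M.
      exists (Ordinal tM); rewrite ler_pdivrMr // ler_pdivlMr //= [a.1 * _]mulrC l1 /=.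
      exact: ltW.
    (* The abscissa 1 truncates to [M] and is put in the last cell. *)
    have M1 : (M.-1 < M)%N by rewrite ltn_predL.
    exists (Ordinal M1); rewrite /w /= prednK // divff ?gt_eqF // a1 andbT.
    rewrite ler_pdivrMr // mulrC; apply: le_trans l1.
    by rewrite ler_nat; exact: leq_trans (leq_pred _) tM.
  have qY : (Num.truncn (M%:R * a.2) < (M * Y).+1)%N.
    have /andP[l1 _] := truncn_itv Ma20.
    by rewrite ltnS -(ler_nat R) natrM; apply: le_trans l1 _; rewrite ler_pM2l // hY.
  have [an|an] := leP (phi n%:R a).1 (w i).
    exists (i, Ordinal qY, None); split => // t /andP[t0 tn].
    by apply: le_trans an; exact: homo.
  have iM : (i.+1 < M)%N.
    have /andP[_ x1] := flow1_bounds n%:R Sa.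
    by have := lt_le_trans an x1; rewrite ltr_pdivrMr // mul1r ltr_nat.
  have [||t] := @IVT R (fun s => (phi s a).1) 0 n%:R (w i) (ler0n _ _).
  - by apply: continuous_subspaceT; exact: (flow1_continuous hphi).
  - have /andP[_ aw] := ia.
    by rewrite (flow_0 hphi) // ge_min aw /= le_max (ltW an) orbT.
  rewrite in_itv /= => /andP[t0 tn] tw.
  have Nt0 : 0 <= N%:R * t by rewrite mulr_ge0.
  have /andP[l1 l2] := truncn_itv Nt0.
  have jn : (Num.truncn (N%:R * t) < (n * N).+1)%N.
    rewrite ltnS -(ler_nat R) natrM; apply: le_trans l1 _.
    by rewrite mulrC ler_wpM2r.
  have jt : (Num.truncn (N%:R * t))%:R / N%:R <= t <= (Num.truncn (N%:R * t)).+1%:R / N%:R.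
    by rewrite ler_pdivrMr // ler_pdivlMr // [t * _]mulrC l1 ltW.
  have Et : phi t a = (w i, (phi t a).2) by rewrite -tw -surjective_pairing.
  have St : strip p eta (w i, (phi t a).2) by rewrite -Et; exact: (flow_strip hphi).
  have := strip_ge0 St; rewrite le_eqVlt => /predU1P[y0|y0].
    exists (i, Ordinal qY, Some (Ordinal jn, ord0)); split => //; split => //.
    by exists t, (phi t a).2; split => //; left; split.
  have [/(_ _ y0 St) SB _] := hS i iM.
  exists (i, Ordinal qY, Some (Ordinal jn, Ordinal (SB : (S i (phi t a).2).+1 < B.+2)%N)).
  split => //; split => //.
  by exists t, (phi t a).2; split => //; right; split.
- move=> a b [[i q] o] Sa Sb Ga Gb m mn; rewrite !(iter_flow hphi) //.
  have m0 : 0 <= m%:R :> R by [].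
  case: o Ga Gb => [[j s]|] Ga Gb; last first.
    have mn' : 0 <= (m%:R : R) <= n%:R by rewrite m0 ler_nat ltnW.
    by case: (Ga) (Gb) => _ _ aw [_ _ bw]; apply: (before i q None); rewrite ?aw ?bw.
  have [_ _ [iM [t [y [tj Et ys]]]]] := Ga; have [_ _ [_ [t' [y' [t'j Et' y's]]]]] := Gb.
  (* If [m <= j / N], neither orbit has left the cell before time [m]. *)
  have [mj|jm] := leqP (m * N) j.
    have mjN : m%:R <= j%:R / N%:R :> R by rewrite ler_pdivlMr // -natrM ler_nat.
    have leave c u v : strip p eta c -> j%:R / N%:R <= u <= j.+1%:R / N%:R ->
        phi u c = (w i, v) -> (phi m%:R c).1 <= w i.
      move=> Sc /andP[ju _] Eu; rewrite -[leRHS]/((w i, v).1) -Eu; apply: homo => //.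
      exact: le_trans ju.
    apply: (before i q (Some (j, s))) => //.
      exact: leave Sa tj Et.
    exact: leave Sb t'j Et'.
  (* Later times are compared with the itineraries at time [m - j / N]; the true exit time exceeds
     [j / N] by at most [1 / N]. *)
  pose r := (m * N - j)%N.
  have rE : r%:R / N%:R = m%:R - j%:R / N%:R :> R.
    by rewrite natrB 1?ltnW // natrM mulrBl mulfK ?gt_eqF.
  have follow c u v : strip p eta c -> j%:R / N%:R <= u <= j.+1%:R / N%:R ->
      phi u c = (w i, v) ->
      `|(phi (r%:R / N%:R) (w i, v)).1 - (phi m%:R c).1| < z /\
      `|(phi (r%:R / N%:R) (w i, v)).2 - (phi m%:R c).2| < z.
    move=> Sc /andP[ju uj] <-; rewrite (flowD hphi) // rE.
    rewrite (_ : _ + u = (u - j%:R / N%:R) + m%:R); last by ring.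
    rewrite -(flowD hphi) //; apply: hd; first exact: (flow_strip hphi).
    rewrite ger0_norm ?subr_ge0 //; apply: ltW; apply: le_lt_trans Nd.
    by rewrite lerBlDl; move: uj; rewrite -natr1 mulrDl mul1r.
  have [a1 a2] := follow _ _ _ Sa tj Et; have [b1 b2] := follow _ _ _ Sb t'j Et'.
  have Sy : strip p eta (w i, y) by rewrite -Et; exact: (flow_strip hphi).
  have Sy' : strip p eta (w i, y') by rewrite -Et'; exact: (flow_strip hphi).
  have rn : (r <= n * N)%N.
    by apply: leq_trans (leq_subr _ _) _; rewrite leq_mul2r ltnW ?orbT.
  have [y1 y2] :
      `|(phi (r%:R / N%:R) (w i, y)).1 - (phi (r%:R / N%:R) (w i, y')).1| < z /\
      `|(phi (r%:R / N%:R) (w i, y)).2 - (phi (r%:R / N%:R) (w i, y')).2| < 3 * z.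
    (* Two codes 0 mean the same exit point at height 0; a code 0 cannot equal a successor. *)
    case: ys y's => [[-> s0]|[y0 sE]] [[->]|[y'0]]; rewrite ?s0 ?sE //.
      by move=> _; rewrite !subrr normr0; split=> //; rewrite mulr_gt0.
    move=> [SE]; exact: (after i y y' r iM y0 y'0 Sy Sy' SE rn).
  apply: le_lt_trans (euclid_dist_le _ _) _.
  have h1 : `|(phi m%:R a).1 - (phi m%:R b).1| <= 3 * z.
    by move: a1 b1 y1; rewrite !ltr_norml ler_norml; lra.
  have h2 : `|(phi m%:R a).2 - (phi m%:R b).2| <= 5 * z.
    by move: a2 b2 y2; rewrite !ltr_norml ler_norml; lra.
  rewrite /z in h1 h2; lra.
- by rewrite lee_fin ler_nat.
Qed.


End upper.

(** * Complexity index of a quadratic growth *)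

Lemma natr_powRN_cvg0 (R : realType) (s : R) : 0 < s ->
  (fun n : nat => n%:R `^ (- s)) @ \oo --> (0 : R).
Proof.
move=> s0; apply/cvgrPdist_lt => e e0.
have /cvgrPdist_lt/(_ e e0) := @powR_cvg0 R s s0.
rewrite near_withinE => /nbhs_ballP[d /= d0 hd].
have [M M0 Md] := inv_natr_lt d0.
exists M => // n /= Mn; have n0 : 0 < n%:R :> R by rewrite ltr0n (leq_trans M0).
have -> : n%:R `^ (- s) = (n%:R^-1 : R) `^ s.
  by rewrite -powR_inv1 ?ler0n // -powRrM mulN1r.
apply: hd; last by rewrite invr_gt0.
rewrite -ball_normE /= sub0r normrN gtr0_norm ?invr_gt0 //.
apply: le_lt_trans Md; rewrite lef_pV2 ?posrE ?ltr0n //; last exact: leq_trans Mn.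
by rewrite ler_nat.
Qed.

Lemma covering_number_ge0 (R : realType) (T : Type) (d : T -> T -> R) (A : set T)
    (f : T -> T) (n : nat) (e : R) : (0 <= covering_number d A f n e)%E.
Proof. by apply: le_ereal_inf_tmp => _ [m _ <-]; rewrite lee_fin. Qed.

(** Every exponent [2 + s] with [s > 0] beats the upper bound. An exponent [s < 2] fails: for
    [n = 2 * N + m0] with [N >= m0] and [N >= 1], the product of [n^-s] and the covering number is
    at least [(3 N)^-s N^2 >= 3^-s]. *)
Lemma complexity_index_quadratic (R : realType) (T : Type) (d : T -> T -> R)
    (A : set T) (f : T -> T) :
  (forall e, 0 < e -> exists C : nat, forall n,
     (covering_number d A f n e <= ((C * (n.+1 * n.+1))%:R)%:E)%E) ->
  (exists2 e, 0 < e & exists m0 : nat, forall N,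
     (((N * N)%:R)%:E <= covering_number d A f (2 * N + m0) e)%E) ->
  complexity_index d A f = (2%:R)%:E.
Proof.
move=> up low; apply/eqP; rewrite eq_le; apply/andP; split.
  apply: ge_ereal_sup => _ [e e0 <-]; apply/lee_addgt0Pr => s s0.
  have [C hC] := up e e0.
  apply: ge_ereal_inf; exists (2 + s)%:E; last by [].
  exists (2 + s) => //; split; first by rewrite addr_ge0 // ltW.
  (* The factor 4 comes from [(n + 1)^2 <= 4 n^2] for [n >= 1]. *)
  apply: (@squeeze_cvge _ _ _ _ (fun=> 0%E) _
    (fun n : nat => (((4 * C)%:R * n%:R `^ (- s))%:E)%E)).
  - near=> n; apply/andP; split.
      by rewrite mule_ge0 ?covering_number_ge0 // lee_fin powR_ge0.
    have n1 : (1 <= n)%N by near: n; exact: nbhs_infty_ge.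
    have n0 : 0 < n%:R :> R by rewrite ltr0n.
    apply: le_trans (lee_wpmul2l _ (hC n)) _; first by rewrite lee_fin powR_ge0.
    rewrite -EFinM lee_fin opprD powRD; last by rewrite [n%:R == 0]gt_eqF ?implybT.
    rewrite powRN powR_mulrn ?ler0n // mulrAC ler_wpM2r ?powR_ge0 // mulrC.
    rewrite ler_pdivrMr ?exprn_gt0 // -natrX -natrM ler_nat; nia.
  - exact: cvg_cst.
  - apply: cvg_EFin; first by near=> n.
    rewrite -[X in _ --> X](mulr0 (4 * C)%:R).
    by apply: cvgM; [exact: cvg_cst|exact: natr_powRN_cvg0].
have [e e0 [m0 hm]] := low.
apply: le_ereal_sup_tmp; eexists; first by exists e.
apply: le_ereal_inf_tmp => _ [s [s0 cs] <-]; rewrite lee_fin leNgt; apply/negP => s2.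
have c0 : 0 < 3 `^ (- s) :> R by exact: powR_gt0.
have := cs _ (open_ereal_lt' (_ : (0 < (3 `^ (- s))%:E)%E)); rewrite lte_fin => /(_ c0).
move=> [n0 _ hn].
pose N := (maxn n0 (maxn m0 1))%N.
have : (n0 <= 2 * N + m0)%N by rewrite /N; lia.
move=> /hn /=; apply/negP; rewrite -leNgt.
apply: le_trans (lee_wpmul2l _ (hm N)); last by rewrite lee_fin powR_ge0.
have N0 : (0 < N)%N by rewrite /N; lia.
have N0' : 0 < N%:R :> R by rewrite ltr0n.
have N1 : 1 <= N%:R :> R by rewrite ler1n.
rewrite -EFinM lee_fin.
have h1 : (3 * N%:R) `^ (- s) <= (2 * N + m0)%:R `^ (- s) :> R.
  rewrite !powRN lef_pV2 ?posrE ?powR_gt0 ?mulr_gt0 ?ltr0n //; last by rewrite addn_gt0 muln_gt0 N0.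
  apply: ge0_ler_powR => //; rewrite ?nnegrE ?mulr_ge0 //.
  by rewrite -natrM ler_nat /N; lia.
have h2 : N%:R `^ s <= (N * N)%:R :> R.
  by rewrite natrM -expr2 -powR_mulrn //; apply: ler_powR => //; exact: ltW.
apply: (@le_trans _ _ ((3 * N%:R) `^ (- s) * (N * N)%:R)); last by rewrite ler_wpM2r.
rewrite powRM // -mulrA ler_peMr ?powR_ge0 // powRN.
by rewrite mulrC ler_pdivlMr ?powR_gt0 // mul1r.
Unshelve. all: end_near. Qed.

Theorem theorem3 (R : realType) (p : nat) (hp : (2 <= p)%N) (eta : R -> R)
    (heta : profile p eta) (V : R * R -> R * R) (phi : R -> R * R -> R * R)
    (hV : asymptotic_model p eta V) (hphi : global_flow p eta V phi)
    (htorsion : torsion p eta phi) (htame : tame p eta phi) :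
  complexity_index (@euclid_dist R) (strip p eta) (phi 1%R) = (2%:R)%:E.
Proof.
apply: complexity_index_quadratic.
  exact: covering_number_quadratic_upper hp heta hV hphi htorsion.
exact: covering_number_quadratic_lower hp heta hV hphi.
Qed.
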